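(* Let $r\ge3$ and let $\ell_1$ be the top Lyapunov exponent of the walk $\mathcal W$, i.e. the number $\ell_1>0$ such that for $\mu_{\mathcal W}$-a.e. trajectory $\theta_1,\theta_2,\dots$ of $\mathcal W$ one has $\lim_{n\to\infty}\frac1n\log\|M(g_{\theta_n})\cdots M(g_{\theta_1})\|=\ell_1$. Then, for $\mu_{\mathcal W}$-a.e. trajectory $\omega=\theta_1,\theta_2,\dots$ of $\mathcal W$, the following hold: (1) With $\mathfrak t_n=\theta_1,\dots,\theta_n$ for $n\ge1$, \[0<\ell_1/2\le\liminf_{n\to\infty}\frac1n\log\lambda(g_{\mathfrak t_n})\le\limsup_{n\to\infty}\frac1n\log\lambda(g_{\mathfrak t_n})\le\ell_1.\] (2) For any strictly increasing sequence of indices $1\le n_1<n_2<n_3<\dots$ such that for each $i\ge1$ the sequence $\mathfrak t_{n_i}=\theta_1,\dots,\theta_{n_i}$ is cyclically admissible, we have \[0<\ell_1/2\le\liminf_{i\to\infty}\frac1{n_i}\log\lambda(\phi_{n_i})\le\limsup_{i\to\infty}\frac1{n_i}\log\lambda(\phi_{n_i})\le\ell_1,\] where $\phi_{n_i}\in\mathrm{Out}(F_r)$ is the outer automorphism represented by $g_{\mathfrak t_{n_i}}$.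
   Context: $F_r$ is the free group with fixed free basis $A=\{a_1,\dots,a_r\}$. A standard Nielsen automorphism $\theta=[x\mapsto yx]$ (where $x,y\in A^{\pm1}$, $y\ne x^{\pm1}$) is the automorphism with $\theta(x)=yx$ and $\theta(z)=z$ for $z\in A^{\pm1}\setminus\{x,x^{-1}\}$; $S$ is the set of all of these. An ordered pair $([x\mapsto yx],[x'\mapsto y'x'])$ is admissible if either $x'=x$ and $y'\ne y^{-1}$, or $y'=x$ and $x'\ne y^{-1}$. A sequence $\theta_1,\dots,\theta_n$ is cyclically admissible if $(\theta_i,\theta_{i+1})$ for $1\le i<n$ and $(\theta_n,\theta_1)$ are all admissible. For each $\theta\in S$ exactly $4r-6$ elements $\theta'\in S$ have $(\theta,\theta')$ admissible. $\mathcal W$ is the Markov chain with state set $S$, uniform initial distribution, and transition probability from $\theta$ to $\theta'$ equal to $1/(4r-6)$ if $(\theta,\theta')$ is admissible and $0$ otherwise; $\mu_{\mathcal W}$ is the corresponding probability measure on the space $S^{\mathbb N}$ of trajectories. The rose $R_r$ is the wedge of $r$ loop-edges $e_1,\dots,e_r$ labelled $a_1,\dots,a_r$, with $\pi_1(R_r)=F_r$. For $\theta=[x\mapsto yx]$, $g_\theta:R_r\to R_r$ is the graph map sending the oriented edge $x$ to the edge-path $yx$ and fixing the other edges. For $\mathfrak t=\theta_1,\dots,\theta_n$ put $g_{\mathfrak t}=g_{\theta_n}\circ\dots\circ g_{\theta_1}$; it represents the outer class of $\theta_n\circ\dots\circ\theta_1$. The transition matrix $M(f)$ of a graph map $f:R_r\to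 R_r$ is the $r\times r$ matrix whose $(i,j)$ entry is the number of occurrences of $e_i$ and $\overline{e_i}$ in the edge-path $f(e_j)$; $M(g_{\mathfrak t})=M(g_{\theta_n})\cdots M(g_{\theta_1})$. $\lambda(f)$ is the spectral radius of $M(f)$. $\|\cdot\|$ is the operator norm on $r\times r$ matrices associated with the Euclidean norm on $\mathbb R^r$. The stretch factor of $\phi\in\mathrm{Out}(F_r)$ is $\lambda(\phi)=\sup_{w\in F_r\setminus\{1\}}\limsup_{n\to\infty}\sqrt[n]{\|\phi^n(w)\|_A}$, where $\|w\|_A$ is the cyclically reduced length of $w$ over $A$. *)

(* Defs.v *)
From HB Require Import structures.
From mathcomp Require Import all_boot all_order all_algebra.
From mathcomp Require Import generic_quotient complex.
From mathcomp Require Import all_classical all_reals all_analysis.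
Set Implicit Arguments.
Unset Strict Implicit.
Unset Printing Implicit Defensive.
Import Order.TTheory GRing.Theory Num.Theory.
Import numFieldNormedType.Exports.
Local Open Scope classical_set_scope.
Local Open Scope ring_scope.
Local Open Scope quotient_scope.

(* (i, false) is the basis element a_i (the edge e_i of the rose) and
   (i, true) is its inverse (the edge e_i traversed backwards). *)
Definition letter (r : nat) := ('I_r * bool)%type.

Definition linv r (x : letter r) : letter r := (x.1, ~~ x.2).

Definition winv r (w : seq (letter r)) : seq (letter r) := rev (map (@linv r) w).

Definition reduced r (w : seq (letter r)) : bool :=
  sorted (fun x y => y != linv x) w.

Definition push r (x : letter r) (w : seq (letter r)) : seq (letter r) :=
  if w is y :: w' then if y == linv x then w' else x :: w else [:: x].

Definition reduce r (w : seq (letter r)) : seq (letter r) :=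
  foldr (@push r) [::] w.

Section Words.
Variable r : nat.
Implicit Types (x y : letter r) (u v w : seq (letter r)).

Lemma linvK : involutive (@linv r).
Proof. by case=> i b; rewrite /linv /= negbK. Qed.

Lemma winvK : involutive (@winv r).
Proof.
move=> w; rewrite /winv map_rev revK -map_comp -[RHS]map_id.
by apply: eq_map => x /=; exact: linvK.
Qed.

Lemma winv_cat u v : winv (u ++ v) = winv v ++ winv u.
Proof. by rewrite /winv map_cat rev_cat. Qed.

Lemma winv_cons x w : winv (x :: w) = winv w ++ [:: linv x].
Proof. by rewrite /winv /= rev_cons cats1. Qed.

Lemma reduced_winv w : reduced w -> reduced (winv w).
Proof.
rewrite /reduced /winv rev_sorted sorted_map; apply: sub_sorted => x y.
by apply: contra => /eqP /= xy; rewrite -(linvK y) -xy.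
Qed.

Lemma reduced_push x w : reduced w -> reduced (push x w).
Proof.
case: w => [//|y w] /=; case: ifPn => [_|yx] /=; last by rewrite yx.
exact: path_sorted.
Qed.

Lemma reduced_foldr v w : reduced v -> reduced (foldr (@push r) v w).
Proof. by move=> rv; elim: w => //= x w; exact: reduced_push. Qed.

Lemma reduced_reduce w : reduced (reduce w).
Proof. exact: reduced_foldr. Qed.

Lemma reduce_id w : reduced w -> reduce w = w.
Proof.
elim: w => //= x w IHw xw; have rw : reduced w := path_sorted xw.
by rewrite IHw//; case: w xw {IHw rw} => //= y w /andP[/negbTE -> _].
Qed.

Lemma pushK x w : reduced w -> push x (push (linv x) w) = w.
Proof.
case: w => [|y w] /=; first by rewrite eqxx.
rewrite linvK; case: eqP => [->|_ _] /=; last by rewrite eqxx.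
by case: w => //= z w /andP[/negbTE ->].
Qed.

Lemma foldr_reduce v w : reduced v ->
  foldr (@push r) v (reduce w) = foldr (@push r) v w.
Proof.
move=> rv; elim: w => //= x w <-.
case: (reduce w) => //= y w'; case: eqP => //= ->.
by rewrite pushK// reduced_foldr.
Qed.

Lemma reduce_cat u v : reduce (u ++ v) = foldr (@push r) (reduce v) u.
Proof. exact: foldr_cat. Qed.

Lemma reduce_catl u v : reduce (reduce u ++ v) = reduce (u ++ v).
Proof. by rewrite !reduce_cat foldr_reduce// reduced_reduce. Qed.

Lemma reduce_catr u v : reduce (u ++ reduce v) = reduce (u ++ v).
Proof. by rewrite !reduce_cat (reduce_id (reduced_reduce v)). Qed.

Lemma foldr_winvl v w : reduced v -> foldr (@push r) v (winv w ++ w) = v.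
Proof.
move=> rv; elim: w => //= x w; rewrite winv_cons -catA /= !foldr_cat /=.
by rewrite -{2}(linvK x) pushK// reduced_foldr.
Qed.

Lemma reduce_winvl w : reduce (winv w ++ w) = [::].
Proof. exact: foldr_winvl. Qed.

Lemma reduce_winv w : reduce (winv w) = winv (reduce w).
Proof.
have rw : reduced (winv (reduce w)) by exact/reduced_winv/reduced_reduce.
rewrite -[winv w]cats0 -(reduce_winvl (winv (reduce w))) winvK reduce_catr.
rewrite catA -reduce_catl -(reduce_catr (winv w)).
rewrite [reduce (reduce w)]reduce_id ?reduced_reduce// reduce_catr.
by rewrite reduce_winvl /= reduce_id.
Qed.

End Words.

(* The free group F_r, realised on the reduced words over A^{+-1}. *)
Record free_group (r : nat) := FreeGroup {
  word :> seq (letter r);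
  _ : reduced word }.

HB.instance Definition _ r := [isSub for @word r].
HB.instance Definition _ r := [Choice of free_group r by <:].

Definition fg_reduce r (w : seq (letter r)) : free_group r :=
  FreeGroup (reduced_reduce w).

Section FreeGroupLaw.
Variable r : nat.
Implicit Types u v w : free_group r.

Definition fg_one : free_group r := @FreeGroup r [::] isT.
Definition fg_inv w : free_group r :=
  FreeGroup (@reduced_winv r w (valP w)).
Definition fg_mul u v : free_group r := fg_reduce (u ++ v).

Lemma fg_mulA : associative fg_mul.
Proof. by move=> u v w; apply: val_inj; rewrite /= reduce_catl reduce_catr catA. Qed.
Lemma fg_mul1 : left_id fg_one fg_mul.
Proof. by move=> w; apply: val_inj; rewrite /= reduce_id// (valP w). Qed.
Lemma fg_1mul : right_id fg_one fg_mul.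
Proof. by move=> w; apply: val_inj; rewrite /= cats0 reduce_id// (valP w). Qed.
Lemma fg_mulV : left_inverse fg_one fg_inv fg_mul.
Proof. by move=> w; apply: val_inj; rewrite /= reduce_winvl. Qed.
Lemma fg_Vmul : right_inverse fg_one fg_inv fg_mul.
Proof.
by move=> w; apply: val_inj; rewrite /= -{1}(winvK w) reduce_winvl.
Qed.

End FreeGroupLaw.

HB.instance Definition _ r := isGroup.Build (free_group r)
  (@fg_mulA r) (@fg_mul1 r) (@fg_1mul r) (@fg_mulV r) (@fg_Vmul r).

(* One step of cyclic reduction: cancel the first letter against the last. *)
Definition cyc_step r (w : seq (letter r)) : seq (letter r) :=
  if w is x :: w' then
    if last x w' == linv x then behead (belast x w') else w
  else w.

(* [size w] steps are enough to make a reduced word cyclically reduced. *)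
Definition cyc_length r (w : free_group r) : nat :=
  size (iter (size (word w)) (@cyc_step r) w).

Record aut (r : nat) := Aut {
  aut_fun :> {multiplicative free_group r -> free_group r};
  aut_bij : bijective aut_fun }.

HB.instance Definition _ r := gen_eqMixin (aut r).
HB.instance Definition _ r := gen_choiceMixin (aut r).

Definition aut_id r : aut r :=
  @Aut r idfun (Bijective (fun=> erefl) (fun=> erefl)).

Definition aut_comp r (Phi Psi : aut r) : aut r :=
  @Aut r (Phi \o Psi) (bij_comp (aut_bij Phi) (aut_bij Psi)).

Definition out_rel r : rel (aut r) := fun Phi Psi =>
  `[< exists g : free_group r, forall w, Phi w = (Psi w ^ g)%g >].

Lemma out_rel_refl r : reflexive (@out_rel r).
Proof. by move=> Phi; apply/asboolP; exists 1%g => w; rewrite conjg1. Qed.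

Lemma out_rel_sym r : symmetric (@out_rel r).
Proof.
suff sub Phi Psi : @out_rel r Phi Psi -> out_rel Psi Phi.
  by move=> Phi Psi; apply/idP/idP; exact: sub.
move=> /asboolP[g Hg]; apply/asboolP; exists g^-1%g => w.
by rewrite Hg conjgK.
Qed.

Lemma out_rel_trans r : transitive (@out_rel r).
Proof.
move=> Psi Phi Chi /asboolP[g Hg] /asboolP[h Hh]; apply/asboolP.
by exists (h * g)%g => w; rewrite Hg Hh conjgM.
Qed.

Definition out_equiv r :=
  EquivRel (@out_rel r) (@out_rel_refl r) (@out_rel_sym r) (@out_rel_trans r).

(* Out(F_r) = Aut(F_r) / Inn(F_r). *)
Definition Out (r : nat) := {eq_quot (@out_equiv r)}.
HB.instance Definition _ r := Choice.on (Out r).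
HB.instance Definition _ r := EqQuotient.on (Out r).

Definition outer r (Phi : aut r) : Out r := \pi_(Out r) Phi.

(* phi^n(w) is a conjugacy class, and [cyc_length] does not depend on the
   automorphism [repr phi] chosen to represent phi. *)
Definition stretch_factor (R : realType) r (phi : Out r) : \bar R :=
  ereal_sup
    [set limn_esup
       (fun n => ((cyc_length (iter n (repr phi) w))%:R `^ n%:R^-1)%:E)
    | w in [set w : free_group r | w <> 1%g]].

(* A graph map R_r -> R_r, given by the edge-path (not necessarily reduced)
   that is the image of each e_i. *)
Definition rose_map (r : nat) := 'I_r -> seq (letter r).

Definition rose_edge r (f : rose_map r) (x : letter r) : seq (letter r) :=
  if x.2 then winv (f x.1) else f x.1.

Definition rose_path r (f : rose_map r) (p : seq (letter r)) :=
  flatten (map (rose_edge f) p).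

Definition rose_id r : rose_map r := fun i => [:: (i, false)].

Definition rose_comp r (f g : rose_map r) : rose_map r :=
  fun i => rose_path f (g i).

Definition rose_pi1 r (f : rose_map r) (w : free_group r) : free_group r :=
  fg_reduce (rose_path f w).

Definition represents r (f : rose_map r) (phi : Out r) : Prop :=
  exists2 Phi : aut r, phi = outer Phi & forall w, Phi w = rose_pi1 f w.

Definition transition_mx (R : realType) r (f : rose_map r) : 'M[R]_r :=
  \matrix_(i, j) (count (fun x : letter r => x.1 == i) (f j))%:R.

Definition nielsen_pair r (xy : letter r * letter r) : bool :=
  (xy.2 != xy.1) && (xy.2 != linv xy.1).

(* The set S: the pair (x, y) stands for [x |-> yx]. *)
Definition nielsen (r : nat) := {xy : letter r * letter r | nielsen_pair xy}.

Definition nsrc r (t : nielsen r) : letter r := (val t).1.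
Definition nmul r (t : nielsen r) : letter r := (val t).2.

(* g_theta; if x is a backward edge, the path of x^-1 is (yx)^-1. *)
Definition nielsen_map r (t : nielsen r) : rose_map r := fun i =>
  if (i, false) == nsrc t then [:: nmul t; nsrc t]
  else if (i, true) == nsrc t then winv [:: nmul t; nsrc t]
  else [:: (i, false)].

(* g_(theta_1, ..., theta_n) = g_theta_n \o ... \o g_theta_1. *)
Definition rose_of_seq r (t : seq (nielsen r)) : rose_map r :=
  foldl (fun g th => rose_comp (nielsen_map th) g) (@rose_id r) t.

Section InducedAutomorphisms.
Variable r : nat.
Implicit Types (f g : rose_map r) (p q : seq (letter r)) (t : nielsen r).

Lemma rose_path_cat f p q : rose_path f (p ++ q) = rose_path f p ++ rose_path f q.
Proof. by rewrite /rose_path map_cat flatten_cat. Qed.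

Lemma rose_edge_linv f x : rose_edge f (linv x) = winv (rose_edge f x).
Proof. by case: x => i []; rewrite /rose_edge //= winvK. Qed.

Lemma rose_path_winv f p : rose_path f (winv p) = winv (rose_path f p).
Proof.
elim: p => // x p IHp; rewrite winv_cons rose_path_cat IHp.
by rewrite /rose_path /= cats0 winv_cat rose_edge_linv.
Qed.

Lemma reduce_rose_path f p : reduce (rose_path f (reduce p)) = reduce (rose_path f p).
Proof.
elim: p => //= x p IHp.
rewrite -[x :: p]cat1s rose_path_cat -reduce_catr -IHp reduce_catr -rose_path_cat.
case: (reduce p) => //= y q; case: eqP => //= ->.
rewrite /rose_path /= rose_edge_linv catA -reduce_catl.
by rewrite -{1}(winvK (rose_edge f x)) reduce_winvl.
Qed.

Lemma rose_path_comp f g p : rose_path (rose_comp f g) p = rose_path f (rose_path g p).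
Proof.
elim: p => // x p IHp; rewrite /rose_path /= -!/(rose_path _ _) IHp.
rewrite rose_path_cat; congr (_ ++ _); case: x => i []; last by [].
exact/esym/rose_path_winv.
Qed.

Lemma rose_pi1_comp f g w :
  rose_pi1 (rose_comp f g) w = rose_pi1 f (rose_pi1 g w).
Proof. by apply: val_inj; rewrite /= rose_path_comp reduce_rose_path. Qed.

Lemma rose_pi1_eqid f :
  (forall i, reduce (f i) = [:: (i, false)]) -> forall w, rose_pi1 f w = w.
Proof.
move=> fE w; apply: val_inj => /=; rewrite -[RHS]reduce_id ?(valP w)//.
elim: (word w) => // x p IHp.
have -> : rose_path f (x :: p) = rose_edge f x ++ rose_path f p by [].
rewrite -reduce_catr IHp reduce_catr -reduce_catl.
suff -> : reduce (rose_edge f x) = [:: x] by [].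
by case: x => i []; rewrite /rose_edge /= ?reduce_winv fE.
Qed.

Lemma rose_pi1M f : {morph rose_pi1 f : u v / (u * v)%g}.
Proof.
move=> u v; apply: val_inj.
by rewrite /= reduce_rose_path rose_path_cat reduce_catl reduce_catr.
Qed.

Lemma nielsen_inv_subproof t :
  nielsen_pair (nsrc t, linv (nmul t)).
Proof.
have /andP[] := valP t; rewrite -/(nsrc t) -/(nmul t).
move: (nsrc t) (nmul t) => x y yx yxV; apply/andP; split.
  by apply: contra yxV => /eqP /= <-; rewrite linvK.
by apply: contra yx => /eqP/(can_inj (@linvK r)) ->.
Qed.

(* [x |-> y^-1 x] *)
Definition nielsen_inv t : nielsen r := exist [eta @nielsen_pair r] _ (nielsen_inv_subproof t).

Lemma nielsen_invK : involutive nielsen_inv.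
Proof.
by case=> [[x y] xyP]; apply: val_inj; rewrite /= /nsrc /nmul /= linvK.
Qed.

Lemma nielsen_nmul1 t : (nmul t).1 != (nsrc t).1.
Proof.
have /andP[] := valP t; rewrite -/(nsrc t) -/(nmul t).
case: (nsrc t) (nmul t) => [j b] [k c]; rewrite /linv !xpair_eqE /=.
by case: eqP => //= _; case: b c => [] [].
Qed.

Lemma rose_edge_nsrc t : rose_edge (nielsen_map t) (nsrc t) = [:: nmul t; nsrc t].
Proof.
rewrite /rose_edge /nielsen_map; case E : (nsrc t) => [j []] /=.
  by rewrite xpair_eqE andbF eqxx winvK.
by rewrite eqxx.
Qed.

Lemma nielsen_map_id t i : i != (nsrc t).1 -> nielsen_map t i = [:: (i, false)].
Proof.
rewrite /nielsen_map; case: (nsrc t) => j b /= /negbTE ij.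
by rewrite !xpair_eqE ij.
Qed.

Lemma rose_edge_id t x : x.1 != (nsrc t).1 -> rose_edge (nielsen_map t) x = [:: x].
Proof. by case: x => i [] /= ij; rewrite /rose_edge /= nielsen_map_id. Qed.

Lemma nielsen_map_inv t w :
  rose_pi1 (nielsen_map (nielsen_inv t)) (rose_pi1 (nielsen_map t) w) = w.
Proof.
rewrite -rose_pi1_comp; apply: rose_pi1_eqid => i {w}.
rewrite /rose_comp; set g := nielsen_map (nielsen_inv t).
have gx : reduce (rose_path g [:: nmul t; nsrc t]) = [:: nsrc t].
  rewrite /rose_path /= cats0 {1}/g rose_edge_id ?nielsen_nmul1//.
  rewrite {}/g (rose_edge_nsrc (nielsen_inv t)).
  rewrite -[[:: nmul t]](winvK) -[X in _ ++ X]/([:: linv (nmul t)] ++ [:: nsrc t]).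
  by rewrite catA -reduce_catl reduce_winvl.
have [ix|ix] := eqVneq i (nsrc t).1; last first.
  by rewrite nielsen_map_id// /rose_path /= cats0 rose_edge_id.
rewrite {1}/nielsen_map; case: eqP => [->//|xF]; case: eqP => [xT|xT].
  by rewrite rose_path_winv reduce_winv gx -xT.
by case: (nsrc t) ix xF xT => j [] /= ->.
Qed.

HB.instance Definition _ f :=
  isMultiplicative.Build (free_group r) (free_group r) (rose_pi1 f) (@rose_pi1M f).

Lemma nielsen_bij t : bijective (rose_pi1 (nielsen_map t)).
Proof.
exists (rose_pi1 (nielsen_map (nielsen_inv t))) => w; first exact: nielsen_map_inv.
by rewrite -{1}(nielsen_invK t) nielsen_map_inv.
Qed.

(* theta = [x |-> yx] *)
Definition nielsen_aut t : aut r := @Aut r (rose_pi1 (nielsen_map t)) (nielsen_bij t).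

(* theta_n \o ... \o theta_1 *)
Definition aut_of_seq (ts : seq (nielsen r)) : aut r :=
  foldl (fun Phi t => aut_comp (nielsen_aut t) Phi) (aut_id r) ts.

Lemma aut_of_seqE ts w : aut_of_seq ts w = rose_pi1 (rose_of_seq ts) w.
Proof.
elim/last_ind: ts => [|ts t IHts] /=.
  by rewrite rose_pi1_eqid.
by rewrite /aut_of_seq /rose_of_seq !foldl_rcons /= rose_pi1_comp -IHts.
Qed.

Lemma represents_rose_of_seq ts :
  represents (rose_of_seq ts) (outer (aut_of_seq ts)).
Proof. by exists (aut_of_seq ts) => // w; exact: aut_of_seqE. Qed.

End InducedAutomorphisms.

Definition admissible r (t t' : nielsen r) : bool :=
  (nsrc t' == nsrc t) && (nmul t' != linv (nmul t))
  || (nmul t' == nsrc t) && (nsrc t' != linv (nmul t)).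

Definition cyclically_admissible r (ts : seq (nielsen r)) : bool :=
  cycle (@admissible r) ts.

(* The type of trajectories S^N; theta_(k+1) is [w k]. The bound on r is an
   argument because a measurable type has to be inhabited. *)
Definition trajectories r (_ : (3 <= r)%N) := nat -> nielsen r.

Lemma nielsen_point_subproof r (hr : (3 <= r)%N) :
  nielsen_pair ((Ordinal (ltnW (ltnW hr)), false), (Ordinal (ltnW hr), false)).
Proof. by []. Qed.

HB.instance Definition _ r (hr : (3 <= r)%N) := gen_eqMixin (trajectories hr).
HB.instance Definition _ r (hr : (3 <= r)%N) := gen_choiceMixin (trajectories hr).
HB.instance Definition _ r (hr : (3 <= r)%N) :=
  isPointed.Build (trajectories hr) 
    (fun=> exist [eta @nielsen_pair r] _ (nielsen_point_subproof hr)).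

Definition coordinate_sets r (hr : (3 <= r)%N) : set (set (trajectories hr)) :=
  [set A | exists n t, A = [set w | w n = t]].

(* S^N with the product sigma-algebra. *)
Definition trajectory_space r (hr : (3 <= r)%N) :=
  g_sigma_algebraType (@coordinate_sets r hr).

Definition initial_prob (R : realType) r : R := #|{: nielsen r}|%:R^-1.

Definition transition_prob (R : realType) r (t t' : nielsen r) : R :=
  if admissible t t' then (4 * r - 6)%:R^-1 else 0.

(* mu is the law of the Markov chain W: its values on cylinders, which
   determine it, are the products of initial and transition probabilities. *)
Definition is_walk_measure (R : realType) r (hr : (3 <= r)%N)
    (mu : probability (trajectory_space hr) R) : Prop :=
  forall (n : nat) (s : nat -> nielsen r),
    mu [set w : trajectory_space hr | forall k, (k <= n)%N -> w k = s k] =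
    (initial_prob R r * \prod_(k < n) transition_prob R (s k) (s k.+1))%:E.

Definition enorm (R : realType) n (v : 'cV[R]_n) : R :=
  Num.sqrt (\sum_i v i 0 ^+ 2).

Definition opnorm (R : realType) n (M : 'M[R]_n) : R :=
  sup [set enorm (M *m v) | v in [set v : 'cV[R]_n | enorm v <= 1]].

Definition spectral_radius (R : realType) n (M : 'M[R]_n) : R :=
  sup [set ComplexField.Normc.normc z | z in
    [set z : R[i] | eigenvalue (map_mx (real_complex R) M) z]].

Definition walk_mx (R : realType) r (ts : seq (nielsen r)) : 'M[R]_r :=
  \prod_(t <- rev ts) transition_mx R (nielsen_map t).

Definition is_top_lyapunov (R : realType) r (hr : (3 <= r)%N)
    (mu : probability (trajectory_space hr) R) (l1 : R) : Prop :=
  {ae mu, forall w : trajectory_space hr,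
    (fun n => n%:R^-1 * ln (opnorm (walk_mx R (mkseq w n)))) @ \oo --> l1}.

(* Main.v *)
Require Import Defs.
From mathcomp Require Import all_boot all_order all_algebra.
From mathcomp Require Import generic_quotient complex spectral.
From mathcomp Require Import all_classical all_reals all_analysis.
From mathcomp Require Import lra zify.
Set Implicit Arguments.
Unset Strict Implicit.
Unset Printing Implicit Defensive.
Import Order.TTheory GRing.Theory Num.Theory.
Import numFieldNormedType.Exports.
Local Open Scope classical_set_scope.
Local Open Scope ring_scope.

(* Each matrix M(g_theta) is the identity plus one elementary entry E_{yx}, so
   M(g_{t_n}) is positive as soon as every pair of distinct indices has occurred
   as (y, x); the walk reaches each pair from any state in two steps, hence
   almost surely. If m = M_ab is the largest entry of a positive integer matrix
   M, then M_ba >= 1, so the diagonal entry of M^(2k) at a is at least m^k and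
   sqrt m <= lambda(M) <= r m, where m is comparable to ||M||; the square root is
   the source of the factor 1/2. For a cyclically admissible sequence some loop
   e_i crosses only turns that stay legal under all iterates, so the same two
   bounds hold for the stretch factor. *)

(** * Occurrence counts and transition matrices *)

Definition occ r (i : 'I_r) (p : seq (letter r)) : nat :=
  count (fun x : letter r => x.1 == i) p.

Section Occurrences.
Variable r : nat.
Implicit Types (i j : 'I_r) (p q : seq (letter r)) (f g : rose_map r).

Lemma occ_cat i p q : occ i (p ++ q) = (occ i p + occ i q)%N.
Proof. exact: count_cat. Qed.

Lemma occ_winv i p : occ i (winv p) = occ i p.
Proof. by rewrite /occ /winv count_rev count_map. Qed.

Lemma occ_rose_edge f i (x : letter r) : occ i (rose_edge f x) = occ i (f x.1).
Proof. by rewrite /rose_edge; case: ifP => // _; rewrite occ_winv. Qed.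

Lemma occ_rose_path f i p :
  occ i (rose_path f p) = (\sum_j occ i (f j) * occ j p)%N.
Proof.
elim: p => [|x p IHp]; first by rewrite big1 // => j _; rewrite muln0.
rewrite /rose_path /= occ_cat -/(rose_path f p) IHp occ_rose_edge.
rewrite [RHS](eq_bigr (fun j => occ i (f j) * (x.1 == j) + occ i (f j) * occ j p)%N);
  last by move=> j _; rewrite -mulnDr.
rewrite big_split /=; congr addn; rewrite (bigD1 x.1) //= eqxx muln1 big1 ?addn0 //.
by move=> j; rewrite eq_sym => /negbTE ->; rewrite muln0.
Qed.

Lemma leq_occ_rose_path f i j p : (occ i (f j) * occ j p <= occ i (rose_path f p))%N.
Proof. by rewrite occ_rose_path (bigD1 j) //= leq_addr. Qed.

Lemma occ_size i p : (occ i p <= size p)%N.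
Proof. exact: count_size. Qed.

Lemma size_occ p : size p = (\sum_i occ i p)%N.
Proof.
elim: p => [|x p IHp] /=; first by rewrite big1.
rewrite big_split /= -IHp (bigD1 x.1) //= eqxx big1 // => j.
by rewrite eq_sym => /negbTE ->.
Qed.

Lemma size_rose_path f (K : nat) p :
  (forall i, (size (f i) <= K)%N) -> (size (rose_path f p) <= K * size p)%N.
Proof.
move=> fK; elim: p => // x p IHp; rewrite /rose_path /= size_cat mulnS.
rewrite leq_add // /rose_edge; case: ifP => _ //.
by rewrite /winv size_rev size_map.
Qed.

Lemma transition_mxE (R : realType) f i j :
  transition_mx R f i j = (occ i (f j))%:R.
Proof. by rewrite mxE. Qed.

(** Edge-paths are never tightened, so occurrence counts add without cancellation and composition of
    maps becomes exactly the matrix product. *)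
Lemma transition_mx_comp (R : realType) f g :
  transition_mx R (rose_comp f g) = transition_mx R f *m transition_mx R g.
Proof.
apply/matrixP => i j; rewrite transition_mxE occ_rose_path natr_sum mxE.
by apply: eq_bigr => k _; rewrite !transition_mxE natrM.
Qed.

Lemma rose_of_seq_rcons (ts : seq (nielsen r)) t :
  rose_of_seq (rcons ts t) = rose_comp (nielsen_map t) (rose_of_seq ts).
Proof. exact: foldl_rcons. Qed.

Lemma transition_mx_of_seq (R : realType) (ts : seq (nielsen r)) :
  transition_mx R (rose_of_seq ts) = walk_mx R ts.
Proof.
elim/last_ind: ts => [|ts t IHts].
  rewrite /walk_mx /rev /= big_nil; apply/matrixP => i j.
  by rewrite transition_mxE !mxE /= addn0 eq_sym.
by rewrite rose_of_seq_rcons transition_mx_comp IHts /walk_mx rev_rcons big_cons.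
Qed.

Lemma occ_nielsen_map (t : nielsen r) i : (0 < occ i (nielsen_map t i))%N.
Proof.
have [it|it] := eqVneq i (nsrc t).1; last by rewrite nielsen_map_id //= eqxx.
have := occ_rose_edge (nielsen_map t) i (nsrc t).
by rewrite rose_edge_nsrc -it => <- /=; rewrite it eqxx; lia.
Qed.

Lemma occ_nielsen_mul (t : nielsen r) :
  (0 < occ (nmul t).1 (nielsen_map t (nsrc t).1))%N.
Proof.
have := occ_rose_edge (nielsen_map t) (nmul t).1 (nsrc t).
by rewrite rose_edge_nsrc => <- /=; rewrite eqxx.
Qed.

Lemma occ_rose_of_seq (ts : seq (nielsen r)) i : (0 < occ i (rose_of_seq ts i))%N.
Proof.
elim/last_ind: ts => [|ts t IHts]; first by rewrite /= eqxx.
rewrite rose_of_seq_rcons; apply: leq_trans (leq_occ_rose_path _ i i _).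
by rewrite muln_gt0 occ_nielsen_map.
Qed.

(** Every factor has a positive diagonal, so the entry created by [t] survives multiplication by the
    factors before and after it. *)
Lemma occ_rose_of_seq_mem (ts : seq (nielsen r)) t : t \in ts ->
  (0 < occ (nmul t).1 (rose_of_seq ts (nsrc t).1))%N.
Proof.
elim/last_ind: ts => // ts s IHts; rewrite mem_rcons inE rose_of_seq_rcons.
case/predU1P => [->|/IHts occt].
  apply: leq_trans (leq_occ_rose_path _ _ (nsrc s).1 _).
  by rewrite muln_gt0 occ_nielsen_mul occ_rose_of_seq.
apply: leq_trans (leq_occ_rose_path _ _ (nmul t).1 _).
by rewrite muln_gt0 occ_nielsen_map.
Qed.

(** Two applications of [f] send each e_a to some e_b and each e_b to [occ a (f b)] copies of e_a,
    so every double step gains that factor. *)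
Lemma occ_iter_rose_path f a b p k : (0 < occ b (f a))%N ->
  (occ a (f b) ^ k * occ a p <= occ a (iter k.*2 (rose_path f) p))%N.
Proof.
move=> fba; elim: k => [|k IHk]; first by rewrite mul1n.
rewrite doubleS !iterS expnS -mulnA.
apply: leq_trans (leq_occ_rose_path _ a b _); rewrite leq_mul2l; apply/orP; right.
apply: leq_trans (leq_occ_rose_path _ b a _); apply: (leq_trans IHk).
by rewrite leq_pmull.
Qed.

End Occurrences.

(** * Legal turns *)

Section LegalTurns.
Variable r : nat.
Implicit Types (a b c x : letter r) (p : seq (letter r)) (t : nielsen r).

(* The subword [a b] of an edge-path crosses the turn {a^-1, b}. Right after
   [x |-> yx] the only turn involving the direction x is {x, y^-1}. *)
Definition legal_after t a b : bool :=
  [&& linv a != b,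
      (linv a == nsrc t) ==> (b == linv (nmul t)) &
      (b == nsrc t) ==> (linv a == linv (nmul t))].

(** The derivative of g_theta on directions: the initial edge of the image of [x]. *)
Definition edge_head t x : letter r := if x == nsrc t then nmul t else x.

Lemma head_nielsen_edge t x :
  rose_edge (nielsen_map t) x =
    edge_head t x :: behead (rose_edge (nielsen_map t) x).
Proof.
rewrite /edge_head; have [->|xt] := eqVneq x (nsrc t).
  by rewrite rose_edge_nsrc.
have [xE|xE] := eqVneq x.1 (nsrc t).1; last by rewrite rose_edge_id.
have -> : x = linv (nsrc t).
  apply/eqP; move: xt xE; case: (x) (nsrc t) => [i u] [j v] /=.
  by rewrite /linv !xpair_eqE /= => /[swap] ->; rewrite eqxx /=; case: u v => [] [].
by rewrite rose_edge_linv rose_edge_nsrc.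
Qed.

Lemma last_nielsen_edge t x z :
  last z (rose_edge (nielsen_map t) x) = linv (edge_head t (linv x)).
Proof.
rewrite -[x in LHS]linvK rose_edge_linv head_nielsen_edge /=.
by rewrite winv_cons last_cat.
Qed.

(** Write [t] as [x |-> yx] and [t'] as [x' |-> y'x']. The derivative of [t'] never takes the value
    x', so the image turn can only fail by degenerating, and the only nondegenerate turn that
    degenerates is {x', y'}. By admissibility this turn contains x but is not {x, y^-1}, so it was
    not legal after [t]. *)
Lemma legal_after_head t t' a b : admissible t t' ->
  legal_after t a b ->
  legal_after t' (linv (edge_head t' (linv a))) (edge_head t' b).
Proof.
have /andP[yx' _] := valP t'; rewrite -/(nsrc t') -/(nmul t') in yx'.
rewrite /legal_after linvK; set c := linv a.
have headN z : edge_head t' z != nsrc t'.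
  by rewrite /edge_head; case: ifPn.
rewrite !(negbTE (headN _)) /= andbT => adm /and3P[cb cx bx].
rewrite /edge_head.
have [cE|_] := eqVneq c (nsrc t'); have [bE|_] := eqVneq b (nsrc t') => //.
- by rewrite cE bE eqxx in cb.
- apply/negP => /eqP bE; move: cx bx; rewrite cE -bE.
  case/orP: adm => /andP[/eqP xE nE]; first by rewrite xE eqxx (negbTE nE).
  by rewrite xE eqxx (negbTE nE) implybF.
- apply/negP => /eqP cE; move: cx bx; rewrite bE cE.
  case/orP: adm => /andP[/eqP xE nE]; first by rewrite xE eqxx (negbTE nE) implybF.
  by rewrite xE eqxx (negbTE nE).
Qed.

(** The only images with an interior turn are yx and x^-1 y^-1, and both cross {x, y^-1}, the one
    legal turn at x. *)
Lemma path_nielsen_edge t x :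
  path (legal_after t) (edge_head t x) (behead (rose_edge (nielsen_map t) x)).
Proof.
have /andP[yx yxV] := valP t; rewrite -/(nsrc t) -/(nmul t) in yx yxV.
have [->|xt] := eqVneq x (nsrc t).
  rewrite rose_edge_nsrc /edge_head eqxx /= /legal_after !eqxx !implybT !andbT.
  have yVx : linv (nmul t) != nsrc t by apply: contra yxV => /eqP <-; rewrite linvK.
  by rewrite yVx (negbTE yVx).
have [xE|xE] := eqVneq x.1 (nsrc t).1; last by rewrite rose_edge_id.
have -> : x = linv (nsrc t).
  apply/eqP; move: xt xE; case: (x) (nsrc t) => [i u] [j v] /=.
  by rewrite /linv !xpair_eqE /= => /[swap] ->; rewrite eqxx /=; case: u v => [] [].
rewrite rose_edge_linv rose_edge_nsrc /edge_head /=.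
have -> : (linv (nsrc t) == nsrc t) = false.
  by case: (nsrc t) => j []; rewrite /linv !xpair_eqE andbF.
have yVx : nsrc t != linv (nmul t) by apply: contra yxV => /eqP ->; rewrite linvK.
by rewrite /legal_after linvK !eqxx /= yVx andbT eq_sym (negbTE yVx).
Qed.

Lemma cycle_legal_rose_path t t' p : admissible t t' ->
  cycle (legal_after t) p -> cycle (legal_after t') (rose_path (nielsen_map t') p).
Proof.
move=> adm; pose e x := linv (edge_head t' (linv x)).
(* [e a] is the last letter of the image of [a]. At the junction of two consecutive images only this
   letter and the head of the next image matter, so the induction runs over paths with a free
   starting letter. *)
suff H a q : path (legal_after t) a q ->
    path (legal_after t') (e a) (rose_path (nielsen_map t') q) /\
    last (e a) (rose_path (nielsen_map t') q) = e (last a q).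
  case: p => // x p; rewrite (cycle_path x) /= => /(H _ (x :: p))[legq lastq].
  by rewrite (cycle_path (e (last x p))) lastq.
elim: q a => // b q IHq a /= /andP[ab /IHq[bq ebq]].
rewrite /rose_path /= -/(rose_path _ _) cat_path last_cat last_nielsen_edge.
split=> //; rewrite bq andbT head_nielsen_edge /=.
by rewrite (legal_after_head adm ab) path_nielsen_edge.
Qed.

Lemma cycle_legal_of_seq t (ts : seq (nielsen r)) p : path (@admissible r) t ts ->
  cycle (legal_after t) p ->
  cycle (legal_after (last t ts)) (rose_path (rose_of_seq ts) p).
Proof.
elim/last_ind: ts => [|ts s IHts].
  rewrite /= => _; suff -> : rose_path (@rose_id r) p = p by [].
  by elim: p => //= -[i b] p {2}<-; rewrite /rose_path /rose_edge /rose_id /=; case: b.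
rewrite rcons_path last_rcons rose_of_seq_rcons => /andP[tts adm] legp.
by rewrite rose_path_comp; apply: cycle_legal_rose_path adm (IHts tts legp).
Qed.

Lemma legal_loop t i : i != (nsrc t).1 -> cycle (legal_after t) [:: (i, false)].
Proof.
move=> it; rewrite /= andbT /legal_after /linv /=.
by case: (nsrc t) it => j b /= ij; rewrite !xpair_eqE (negbTE ij) andbF.
Qed.

(** Cyclic admissibility makes the first move admissible after the last one, so legality after the
    last move is reproduced by each full round. The letter [t] is only the default for [last]. *)
Lemma cycle_legal_iter (ts : seq (nielsen r)) t k p :
  cyclically_admissible ts ->
  cycle (legal_after (last t ts)) p ->
  cycle (legal_after (last t ts)) (iter k (rose_path (rose_of_seq ts)) p).
Proof.
rewrite /cyclically_admissible (cycle_path t) => adm legp.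
elim: k => //= k IHk.
have := cycle_legal_of_seq adm IHk.
by rewrite (_ : last (last t ts) ts = last t ts) //; case: (ts).
Qed.

Lemma legal_after_reduced t : subrel (legal_after t) (fun a b => b != linv a).
Proof. by move=> a b /and3P[]; rewrite eq_sym. Qed.

End LegalTurns.

(** * Cyclically reduced words *)

Section ConjugacyLength.
Variable r : nat.
Implicit Types (x : letter r) (s t : seq (letter r)) (u v w g : free_group r).

Definition cyc_reduced s : bool := cycle (fun x y => y != linv x) s.

Lemma cyc_reduced_reduced s : cyc_reduced s -> reduced s.
Proof. by case: s => // x s; rewrite /cyc_reduced /= rcons_path => /andP[]. Qed.

Lemma cyc_reduced_flatten n s : cyc_reduced s -> reduced (flatten (nseq n s)).
Proof.
case: s => [_|x s sP].
  by elim: n.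
suff: path (fun x y => y != linv x) (last x s) (flatten (nseq n (x :: s))).
  exact: path_sorted.
elim: n => // n IHn; rewrite [flatten _]/= -cat_cons cat_path IHn andbT.
by move: sP; rewrite /cyc_reduced (cycle_path x).
Qed.

Lemma size_push x s : (size (push x s) <= (size s).+1)%N.
Proof. by case: s => //= y s; case: ifP => //= _; lia. Qed.

Lemma size_reduce s : (size (reduce s) <= size s)%N.
Proof. by elim: s => //= x s IHs; rewrite (leq_trans (size_push _ _)). Qed.

Lemma fg_reduce_cat s t : fg_reduce (s ++ t) = (fg_reduce s * fg_reduce t)%g.
Proof. by apply: val_inj; rewrite /= reduce_catl reduce_catr. Qed.

Lemma fg_reduce_winv s : fg_reduce (winv s) = (fg_reduce s)^-1%g.
Proof. by apply: val_inj; rewrite /= reduce_winv. Qed.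

Lemma fg_reduceK w : fg_reduce w = w.
Proof. by apply: val_inj; rewrite /= reduce_id // (valP w). Qed.

Lemma fg_reduce_flatten n s : fg_reduce (flatten (nseq n s)) = (fg_reduce s ^+ n)%g.
Proof.
elim: n => [|n IHn]; first by apply: val_inj.
by rewrite [flatten _]/= fg_reduce_cat IHn expgS.
Qed.

Lemma size_fg_mul u v : (size (word (u * v)%g) <= size (word u) + size (word v))%N.
Proof. by rewrite (leq_trans (size_reduce _)) // size_cat. Qed.

Lemma size_fg_inv u : size (word u^-1%g) = size (word u).
Proof. by rewrite /= /winv size_rev size_map. Qed.

Lemma size_fg_conj u g :
  (size (word (u ^ g)%g) <= size (word u) + (size (word g)).*2)%N.
Proof.
rewrite conjgE; apply: leq_trans (size_fg_mul _ _) _.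
apply: leq_trans (leq_add (leqnn _) (size_fg_mul _ _)) _.
by rewrite size_fg_inv; lia.
Qed.

Lemma size_flatten_nseq n s : size (flatten (nseq n s)) = (n * size s)%N.
Proof. by elim: n => //= n IHn; rewrite size_cat IHn mulSn. Qed.

Lemma size_fg_exp n u : (size (word (u ^+ n)%g) <= n * size (word u))%N.
Proof.
by rewrite -{1}(fg_reduceK u) -fg_reduce_flatten -size_flatten_nseq size_reduce.
Qed.

(* Compare the lengths of v^n and of the conjugate element u^n: the first is
   n|v| exactly, the second at most n|u| up to a constant. *)
Lemma cyc_reduced_min u v g : cyc_reduced (word v) -> v = (u ^ g)%g ->
  (size (word v) <= size (word u))%N.
Proof.
(* An exponent larger than 2|g|, so that n|v| <= n|u| + 2|g| already forces |v| <= |u|. *)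
move=> vP vE; pose n := (size (word g)).*2.+1.
have : (n * size (word v) <= n * size (word u) + (size (word g)).*2)%N.
  have <- : size (word (v ^+ n)%g) = (n * size (word v))%N.
    rewrite -{1}(fg_reduceK v) -fg_reduce_flatten /= reduce_id.
      by rewrite -size_flatten_nseq.
    exact: (cyc_reduced_flatten n).
  rewrite vE -conjXg; apply: leq_trans (size_fg_conj _ _) _.
  by rewrite leq_add2r size_fg_exp.
rewrite /n; nia.
Qed.

Lemma cyc_stepP s : reduced s ->
  (cyc_step s = s /\ cyc_reduced s) \/
  exists x, s = x :: rcons (cyc_step s) (linv x).
Proof.
case: s => [|x s]; first by left.
rewrite /cyc_step => redxs; case: eqP => [|/eqP] sx.
  right; exists x; case: s sx {redxs} => [|y s] /= sx.
    by case: x sx => i [] [].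
  by rewrite -sx -lastI.
left; split=> //; rewrite /cyc_reduced /= rcons_path; move: redxs => /= -> /=.
by apply: contra sx => /eqP xE; rewrite [in linv x]xE linvK.
Qed.

(** Each effective step strips a conjugating letter and shortens the word by two. A word on which
    [cyc_step] is idle is cyclically reduced and stays fixed. *)
Lemma cyc_step_iter n s : (size s <= n)%N -> reduced s ->
  cyc_reduced (iter n (@cyc_step r) s) /\
  exists g, fg_reduce (iter n (@cyc_step r) s) = (fg_reduce s ^ g)%g.
Proof.
elim: n s => [|n IHn] s sn redx.
  by case: s sn redx => // _ _; split=> //; exists 1%g; rewrite conjg1.
rewrite iterSr; case: (cyc_stepP redx) => [[-> sP]|[x sE]].
  have -> : iter n (@cyc_step r) s = s.
    case: (cyc_stepP redx) => [[sK _]|[y sE]]; first by elim: n {IHn sn} => //= n ->.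
    exfalso; move: sP; rewrite sE /cyc_reduced /= !rcons_path last_rcons.
    by rewrite linvK eqxx andbF.
  by split=> //; exists 1%g; rewrite conjg1.
have red1 : reduced (cyc_step s).
  move: redx; rewrite {1}sE /reduced /= => /path_sorted.
  by rewrite -cats1 => /cat_sorted2[].
have /IHn/(_ red1)[coreP [g gE]] : (size (cyc_step s) <= n)%N.
  by move: sn; rewrite {1}sE /= size_rcons; lia.
split=> //; exists (fg_reduce [:: x] * g)%g; rewrite gE conjgM; congr (_ ^ g)%g.
rewrite [in RHS]sE -cats1 -cat1s !fg_reduce_cat.
have -> : [:: linv x] = winv [:: x] by [].
by rewrite fg_reduce_winv conjgE !mulgA mulVg mul1g -mulgA mulVg mulg1.
Qed.

(** The word measured by [cyc_length u] is cyclically reduced and conjugate to [v], and such words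
    are shortest in their conjugacy class by [cyc_reduced_min]. *)
Lemma cyc_length_le u v g : u = (v ^ g)%g -> (cyc_length u <= size (word v))%N.
Proof.
move=> uE; have [coreP [h]] := cyc_step_iter (leqnn _) (valP u : reduced (word u)).
have redc := reduce_id (cyc_reduced_reduced coreP).
rewrite fg_reduceK [in X in _ = (X ^ _)%g]uE -conjgM => /cyc_reduced_min.
by rewrite /= redc; apply.
Qed.

Lemma cyc_length_ge u v g : cyc_reduced (word v) -> u = (v ^ g)%g ->
  (size (word v) <= cyc_length u)%N.
Proof.
move=> vP uE; have [coreP [h]] := cyc_step_iter (leqnn _) (valP u : reduced (word u)).
have redc := reduce_id (cyc_reduced_reduced coreP).
rewrite fg_reduceK [in X in _ = (X ^ _)%g]uE -conjgM => hE.
have /(cyc_reduced_min vP) : v = ((v ^ (g * h)) ^ (g * h)^-1)%g by rewrite conjgK.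
by rewrite -hE /= redc.
Qed.

End ConjugacyLength.

(** * Bounds on the stretch factor *)

Section LimitSuperior.
Variable R : realType.
Implicit Types (u v : (\bar R)^nat) (l : R).
Local Open Scope ereal_scope.

Lemma le_limn_esup u v : (\forall n \near \oo, u n <= v n) ->
  limn_esup u <= limn_esup v.
Proof.
move=> uv; rewrite !limn_esup_lim; apply: lee_lim; try exact: is_cvg_esups.
case: uv => N _ uv; exists N => // n /= Nn.
apply: ge_ereal_sup => _ [k /= nk <-].
apply: (le_trans (uv k _)); first exact: leq_trans nk.
by apply: ereal_sup_ubound; exists k.
Qed.

Lemma le_limn_einf u v : (\forall n \near \oo, u n <= v n) ->
  limn_einf u <= limn_einf v.
Proof.
move=> uv; rewrite /limn_einf leeN2; apply: le_limn_esup.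
by apply: filterS uv => n; rewrite leeN2.
Qed.

Lemma limn_einf_ge (l : R) (a : R^nat) u : a @ \oo --> l ->
  (\forall n \near \oo, (a n)%:E <= u n) -> l%:E <= limn_einf u.
Proof.
move=> al au; have alE : (a n)%:E @[n --> \oo] --> l%:E by apply: cvg_EFin => //; apply: nearW.
by rewrite -(cvg_limn_einf_sup alE).1; exact: le_limn_einf.
Qed.

Lemma limn_esup_le (l : R) (a : R^nat) u : a @ \oo --> l ->
  (\forall n \near \oo, u n <= (a n)%:E) -> limn_esup u <= l%:E.
Proof.
move=> al ua; have alE : (a n)%:E @[n --> \oo] --> l%:E by apply: cvg_EFin => //; apply: nearW.
by rewrite -(cvg_limn_einf_sup alE).2; exact: le_limn_esup.
Qed.

End LimitSuperior.

Lemma cvg_natV (R : realType) : (n%:R^-1 : R) @[n --> \oo] --> (0 : R).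
Proof. by rewrite -(cvg_shiftS (fun n => n%:R^-1 : R)); exact: cvg_harmonic. Qed.

(** The shape taken by an n-th root of C K^n, with a = ln K and b = ln C: the constant C disappears
    in the limit. *)
Lemma cvg_expR_affine (R : realType) (a b : R) :
  expR (a + b * n%:R^-1) @[n --> \oo] --> expR a.
Proof.
apply: continuous_cvg; first exact: continuous_expR.
rewrite -[a in _ --> a]addr0 -(mulr0 b); apply: cvgD; first exact: cvg_cst.
by apply: cvgMr; exact: cvg_natV.
Qed.

Section StretchFactor.
Variables (R : realType) (r : nat).
Implicit Types (f : rose_map r) (phi : Out r) (w : free_group r).

Lemma fg_reduce_rose_path f (p : seq (letter r)) :
  fg_reduce (rose_path f p) = rose_pi1 f (fg_reduce p).
Proof. by apply: val_inj; rewrite /= reduce_rose_path. Qed.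

Lemma iter_represents f phi : represents f phi -> forall n w,
  exists g, iter n (repr phi) w = (fg_reduce (iter n (rose_path f) w) ^ g)%g.
Proof.
case=> Phi phiE PhiE n w.
have /asboolP[g gE] : out_rel (repr phi) Phi.
  by apply/(@eqmodP _ (out_equiv r)); rewrite reprK phiE.
elim: n => [|n [h hE]]; first by exists 1%g; rewrite conjg1 fg_reduceK.
(* Conjugators accumulate: applying [Phi] to a conjugate by [h] gives a conjugate by [Phi h], and
   passing from [Phi] to [repr phi] adds [g]. *)
exists (Phi h * g)%g; rewrite !iterS hE gE fg_reduce_rose_path -PhiE conjgM.
by congr (_ ^ _)%g; apply: (mulgI (Phi h)); rewrite -gmulfM !conjgE !mulVKg gmulfM.
Qed.

Lemma stretch_factor_le f phi (K : nat) : represents f phi -> (0 < K)%N ->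
  (forall i, (size (f i) <= K)%N) -> (stretch_factor R phi <= (K%:R)%:E)%E.
Proof.
move=> frep K0 fK; apply: ge_ereal_sup => _ [w _ <-].
rewrite -[K%:R]lnK ?posrE ?ltr0n //.
(* The constant C is |w| + 1; the successor keeps the argument of the logarithm positive. *)
apply: limn_esup_le (@cvg_expR_affine _ _ (ln (size (word w)).+1%:R)) _.
exists 1%N => // n /= n0; rewrite lee_fin.
have n0R : (0 : R) < n%:R by rewrite ltr0n.
have [g gE] := iter_represents frep n w.
have cle : (cyc_length (iter n (repr phi) w) <= K ^ n * (size (word w)).+1)%N.
  apply: leq_trans (cyc_length_le gE) _; apply: leq_trans (size_reduce _) _.
  elim: {gE} n {n0 n0R} => [|n IHn]; first by rewrite mul1n ltnW.
  rewrite iterS expnS -mulnA; apply: leq_trans (size_rose_path _ fK) _.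
  by rewrite leq_mul2l IHn orbT.
apply: (@le_trans _ _ ((K ^ n * (size (word w)).+1)%:R `^ n%:R^-1)).
  by rewrite ge0_ler_powR ?nnegrE ?invr_ge0 ?ler0n // ler_nat.
rewrite /powR pnatr_eq0 muln_eq0 expn_eq0 /= eqn0Ngt K0 /=.
rewrite ler_expR natrM natrX lnM ?posrE ?exprn_gt0 ?ltr0n // lnXn ?ltr0n //.
by rewrite mulrDr -[ln _ *+ n]mulr_natl mulKf ?gt_eqF // [_^-1 * _]mulrC.
Qed.

End StretchFactor.

Lemma occ_iter_pos r (f : rose_map r) (a : 'I_r) (p : seq (letter r)) n :
  (0 < occ a (f a))%N -> (0 < occ a p)%N -> (0 < occ a (iter n (rose_path f) p))%N.
Proof.
move=> faa ap; elim: n => //= n IHn.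
by apply: leq_trans (leq_occ_rose_path _ a a _); rewrite muln_gt0 faa.
Qed.

(* The loop [e_i] stays legal under every iterate of the map, so its iterates
   need no cyclic reduction; every second one gains a factor [m]. *)
Lemma stretch_factor_ge (R : realType) r (ts : seq (nielsen r)) (phi : Out r)
    (a b : 'I_r) (f := rose_of_seq ts) : (1 < r)%N ->
  cyclically_admissible ts -> represents f phi ->
  (forall i k, (0 < occ i (f k))%N) ->
  ((Num.sqrt (occ a (f b))%:R)%:E <= stretch_factor R phi)%E.
Proof.
move=> r1 adm frep fpos; set m := occ a (f b).
have [t0 _] : exists t : nielsen r, True.
  have xyP : @nielsen_pair r ((Ordinal (ltnW r1), false), (Ordinal r1, false)) by [].
  by exists (exist [eta @nielsen_pair r] _ xyP).
(* The loop e_i must avoid the edge twisted by the last move, so that its single turn is legal after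
   that move. *)
have [i it] : exists i, i != (nsrc (last t0 ts)).1.
  case: (nsrc _).1 => -[|k] kr; first by exists (Ordinal r1).
  by exists (Ordinal (ltnW r1)).
pose w : free_group r := fg_reduce [:: (i, false)].
have w1 : w <> 1%g by move/(congr1 (@word r)).
have mE : Num.sqrt m%:R = expR (ln m%:R / 2) :> R.
  apply/eqP; rewrite -(@eqrXn2 _ 2) ?sqrtr_ge0 ?expR_ge0 //.
  rewrite sqr_sqrtr // -expRM_natl -mulrCA divff ?pnatr_eq0 // mulr1.
  by rewrite lnK // posrE ltr0n fpos.
apply: (@le_trans _ _ (limn_esup
    (fun n => ((cyc_length (iter n (repr phi) w))%:R `^ n%:R^-1)%:E)))%E; last first.
  by apply: ereal_sup_ubound; exists w.
apply: (le_trans _ (limn_einf_sup _)).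
(* The correction - ln m / n pays for rounding: [(n.-1)./2] is at least n/2 - 1. *)
rewrite mE; apply: limn_einf_ge (@cvg_expR_affine _ _ (- ln m%:R)) _.
exists 1%N => // n /= n0; rewrite lee_fin.
have n0R : (0 : R) < n%:R by rewrite ltr0n.
have [g gE] := iter_represents frep n w.
have legal := cycle_legal_iter n adm (legal_loop it).
have cyc : cyc_reduced (iter n (rose_path f) [:: (i, false)]).
  by apply: (sub_cycle (@legal_after_reduced _ _)) legal.
(* One or two initial iterations make e_a appear in the image of e_i; the remaining ones come in
   pairs, each pair gaining a factor [m]. *)
have nE : n = ((n.-1)./2.*2 + (odd n.-1).+1)%N.
  by rewrite addnS addnC odd_double_half prednK.
have cge : (m ^ (n.-1)./2 <= cyc_length (iter n (repr phi) w))%N.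
  apply: leq_trans (cyc_length_ge _ gE).
    rewrite /= reduce_id; last exact: cyc_reduced_reduced.
    apply: leq_trans (occ_size a _); rewrite [in leqRHS]nE iterD iterSr.
    apply: leq_trans (occ_iter_rose_path _ _ (fpos b a)).
    rewrite leq_pmulr //; apply: occ_iter_pos => //.
    by apply: leq_trans (leq_occ_rose_path _ a i _); rewrite muln_gt0 fpos /= eqxx.
  by rewrite /= reduce_id //; exact: cyc_reduced_reduced.
have m1 : (1 <= m)%N := fpos _ _.
apply: (@le_trans _ _ ((m ^ (n.-1)./2)%:R `^ n%:R^-1)); last first.
  by rewrite ge0_ler_powR ?nnegrE ?invr_ge0 ?ler0n // ler_nat.
rewrite /powR pnatr_eq0 expn_eq0 eqn0Ngt m1 /= ler_expR natrX lnXn ?ltr0n //.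
have lm : 0 <= ln m%:R :> R by rewrite ln_ge0 // ler1n.
rewrite [leRHS]mulrC -(ler_pM2r n0R) mulrDl !mulfVK ?gt_eqF //.
have -> : n%:R = (n.-1)%:R + 1 :> R by rewrite natr1 prednK.
have : (n.-1)%:R <= ((n.-1)./2)%:R * 2 + 1 :> R.
  by rewrite -natrM natr1 ler_nat; lia.
by rewrite -[ln _ *+ _]mulr_natl; nra.
Qed.

(** * Spectral radius and operator norm *)

Section TriangularPowers.
Variables (F : comNzRingType) (n : nat).
Implicit Types T U : 'M[F]_n.

Lemma trig_expr T k : is_trig_mx T ->
  is_trig_mx (T ^+ k) /\ forall i, (T ^+ k) i i = T i i ^+ k.
Proof.
move=> /is_trig_mxP Ttrig; elim: k => [|k [/is_trig_mxP IHtrig IHdiag]].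
  split=> [|i]; first by rewrite expr0 scalar_mx_is_trig.
  by rewrite !expr0 mxE eqxx.
have TE i j : (T ^+ k.+1) i j = \sum_l T i l * (T ^+ k) l j by rewrite exprS mxE.
split=> [|i].
  apply/is_trig_mxP => i j ij; rewrite TE big1 // => l _.
  have [il|li] := ltnP i l; first by rewrite Ttrig ?mul0r.
  by rewrite IHtrig ?mulr0 // (leq_ltn_trans li).
rewrite TE (bigD1 i) //= IHdiag -exprS big1 ?addr0 // => l.
rewrite -val_eqE neq_ltn => /orP[li|il]; last by rewrite Ttrig ?mul0r.
by rewrite IHtrig ?mulr0.
Qed.

End TriangularPowers.

Lemma mxtrace_conj_expr (F : fieldType) n (P A : 'M[F]_n) k : P \in unitmx ->
  \tr ((P *m A *m invmx P) ^+ k) = \tr (A ^+ k).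
Proof.
move=> Pu; have -> : (P *m A *m invmx P) ^+ k = P *m A ^+ k *m invmx P.
  elim: k => [|k IHk]; first by rewrite !expr0 mulmx1 mulmxV.
  rewrite !exprS {}IHk; change (P *m A *m invmx P *m (P *m A ^+ k *m invmx P) =
    P *m (A *m A ^+ k) *m invmx P).
  by rewrite !mulmxA mulmxKV.
by rewrite mxtrace_mulC mulmxA mulVmx // mul1mx.
Qed.

Lemma eigenvalue_trig_diag (F : fieldType) n (P A : 'M[F]_n)
    (T := P *m A *m invmx P) (i : 'I_n) :
  P \in unitmx -> is_trig_mx T -> eigenvalue A (T i i).
Proof.
move=> Pu Ttrig; have Pfree : row_free P by rewrite row_free_unit.
have /(_ (T i i)) := eigenvalue_conjmx (stablemx_unit A Pu) Pfree.
rewrite (conjumx _ Pu) -/T; apply.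
suff : eigenvalue T (T i i) by [].
rewrite eigenvalue_root_char (char_poly_trig Ttrig); apply/rootP.
by rewrite horner_prod (bigD1 i) //= hornerXsubC subrr mul0r.
Qed.

(** If y < x, then [c * (y / x) ^+ k] tends to 0 while staying at least 1. *)
Lemma le_of_expr_le (R : realType) (x y c : R) : 0 <= y ->
  (forall k, x ^+ k <= c * y ^+ k) -> x <= y.
Proof.
move=> y0 xy; rewrite leNgt; apply/negP => yx.
have x0 : 0 < x by exact: le_lt_trans yx.
have q1 : `|y / x| < 1 by rewrite ger0_norm ?divr_ge0 ?(ltW x0) // ltr_pdivrMr ?mul1r.
have lim0 : c * (y / x) ^+ k @[k --> \oo] --> (0 : R).
  by rewrite -(mulr0 c); apply: cvgMr; exact: cvg_expr.
suff : (1 : R) <= 0 by rewrite ler10.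
rewrite -(cvg_lim _ lim0) //; apply: limr_ge; first by apply/cvg_ex; exists 0.
apply: nearW => k; rewrite expr_div_n mulrA ler_pdivlMr ?exprn_gt0 // mul1r.
exact: xy.
Qed.

Section NonnegativeMatrices.
Variables (R : realType) (n : nat).
Implicit Types (M : 'M[R]_n) (i j : 'I_n).

Local Notation normc := ComplexField.Normc.normc.
Local Notation toC := (map_mx (real_complex R)).

Lemma normc_real (x : R) : 0 <= x -> normc x%:C%C = x.
Proof. by move=> x0; rewrite /= expr0n addr0 sqrtr_sqr ger0_norm. Qed.

Lemma normc_ge0 (z : R[i]) : 0 <= normc z.
Proof. by case: z => a b; exact: sqrtr_ge0. Qed.

Lemma normc_sum (I : finType) (F : I -> R[i]) :
  normc (\sum_i F i) <= \sum_i normc (F i).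
Proof.
elim/big_ind2: _ => [|x1 x2 y1 y2 h1 h2|//]; first by rewrite ComplexField.Normc.normc0.
by apply: le_trans (lerD h1 h2); exact: le_normcD.
Qed.

Lemma normcX (z : R[i]) k : normc (z ^+ k) = normc z ^+ k.
Proof.
elim: k => [|k IHk]; first by rewrite !expr0 ComplexField.Normc.normc1.
by rewrite !exprS ComplexField.Normc.normcM IHk.
Qed.

(** Eigenvectors are rows, hence column sums: compare both sides of the eigenvector equation at a
    coordinate of largest modulus. *)
Lemma eigenvalue_normc_le M (K : R) (z : R[i]) :
  (forall i j, 0 <= M i j) -> (forall j, \sum_i M i j <= K) ->
  eigenvalue (toC M) z -> normc z <= K.
Proof.
move=> M0 MK /eigenvalueP[v vM v0].
have [j0 vj0] : exists j, v 0 j != 0.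
  apply/existsP; apply: contraR v0 => /existsPn v0.
  by apply/eqP/rowP => j; rewrite mxE; apply/eqP; move: (v0 j); rewrite negbK.
case: (@arg_maxP _ R _ j0 xpredT (fun j => normc (v 0 j))) => // j _ maxj.
have vj : 0 < normc (v 0 j).
  apply: lt_le_trans (maxj j0 isT); rewrite lt_neqAle normc_ge0 andbT eq_sym.
  by apply: contra vj0 => /eqP/ComplexField.Normc.eq0_normc ->.
rewrite -(ler_pM2r vj) -ComplexField.Normc.normcM.
have -> : z * v 0 j = \sum_i v 0 i * (M i j)%:C%C.
  move/rowP/(_ j): vM; rewrite !mxE => <-.
  by apply: eq_bigr => i _; rewrite mxE.
apply: le_trans (normc_sum _) _.
apply: le_trans (_ : \sum_i normc (v 0 j) * M i j <= _).
  apply: ler_sum => i _; rewrite ComplexField.Normc.normcM normc_real //.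
  by rewrite ler_wpM2r //; exact: maxj.
by rewrite -mulr_sumr mulrC ler_wpM2r // ltW.
Qed.

Lemma spectral_radius_le M (K : R) : (0 < n)%N ->
  (forall i j, 0 <= M i j) -> (forall j, \sum_i M i j <= K) ->
  spectral_radius M <= K.
Proof.
move=> n0 M0 MK; apply: ge_sup.
  by have [z zP] := eigenvalue_closed (toC M) n0; exists (normc z); exists z.
by move=> _ [z zP <-]; exact: eigenvalue_normc_le zP.
Qed.

(** The column sums bound the set of moduli from above, so that its [sup] is a genuine least upper
    bound and not the default value. *)
Lemma normc_le_spectral_radius M (K : R) (z : R[i]) :
  (forall i j, 0 <= M i j) -> (forall j, \sum_i M i j <= K) ->
  eigenvalue (toC M) z -> normc z <= spectral_radius M.
Proof.
move=> M0 MK zP; apply: ub_le_sup; last by exists z.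
by exists K => _ [t tP <-]; exact: eigenvalue_normc_le tP.
Qed.

Lemma mx_expr_ge0 M k : (forall i j, 0 <= M i j) -> forall i j, 0 <= (M ^+ k) i j.
Proof.
move=> M0; elim: k => [|k IHk] i j; first by rewrite expr0 mxE ler0n.
by rewrite exprS mxE sumr_ge0 // => l _; rewrite mulr_ge0.
Qed.

(** Expanding the power gives nonnegative terms; only the closed walk alternating between [a] and
    [b] is kept. *)
Lemma mx_expr_double_ge M a b k : (forall i j, 0 <= M i j) ->
  (M a b * M b a) ^+ k <= (M ^+ k.*2) a a.
Proof.
move=> M0; elim: k => [|k IHk]; first by rewrite !expr0 mxE eqxx.
have Mle (U : 'M[R]_n) i j l : (forall i j, 0 <= U i j) ->
    M i l * U l j <= (M * U) i j.
  move=> U0; rewrite [leRHS]mxE (bigD1 l) //= lerDl.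
  by rewrite sumr_ge0 // => p _; rewrite mulr_ge0.
rewrite exprS doubleS (exprS M k.*2.+1).
apply: le_trans (Mle _ _ _ b (mx_expr_ge0 _ M0)).
rewrite -mulrA ler_wpM2l // exprS.
by apply: le_trans (Mle _ _ _ a (mx_expr_ge0 _ M0)); rewrite ler_wpM2l.
Qed.

(* The trace of M^(2k) dominates (M_ab M_ba)^k and is the sum of the 2k-th
   powers of the eigenvalues. *)
Lemma spectral_radius_ge M a b : (forall i j, 0 <= M i j) ->
  Num.sqrt (M a b * M b a) <= spectral_radius M.
Proof.
move=> M0; have n0 : (0 < n)%N by exact: leq_ltn_trans (ltn_ord a).
have MK j : \sum_i M i j <= \sum_j \sum_i M i j.
  rewrite [leRHS](bigD1 j) //= lerDl sumr_ge0 // => l _.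
  by rewrite sumr_ge0.
have [P Pu Ttrig] := Schur (toC M) n0.
have {}Pu := unitarymx_unit Pu.
rewrite /similar_to conjumx // in Ttrig; set T := _ *m _ in Ttrig.
have eigT i : eigenvalue (toC M) (T i i) := eigenvalue_trig_diag i Pu Ttrig.
have rho0 : 0 <= spectral_radius M.
  by apply: le_trans (normc_le_spectral_radius M0 MK (eigT a)); exact: normc_ge0.
have Mpos : 0 <= M a b * M b a by rewrite mulr_ge0.
rewrite -(@ler_sqr R) ?nnegrE ?sqrtr_ge0 // sqr_sqrtr //.
(* The trace is a sum of [n] powers of eigenvalues, each of modulus at most the corresponding power
   of the spectral radius; this is the constant [n]. *)
apply: (@le_of_expr_le _ _ _ n%:R) => [|k]; first by rewrite exprn_ge0.
apply: le_trans (mx_expr_double_ge a b k M0) _.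
have tr_ge : (M ^+ k.*2) a a <= \tr (M ^+ k.*2).
  rewrite /mxtrace (bigD1 a) //= lerDl sumr_ge0 // => i _; exact: mx_expr_ge0.
apply: le_trans tr_ge _.
have tr0 : 0 <= \tr (M ^+ k.*2) by rewrite sumr_ge0 // => i _; exact: mx_expr_ge0.
rewrite -(normc_real tr0).
have -> : (\tr (M ^+ k.*2))%:C%C = \sum_i T i i ^+ k.*2.
  rewrite -[LHS](trace_map_mx (real_complex R)).
  have -> : toC (M ^+ k.*2) = toC M ^+ k.*2.
    elim: k.*2 => [|l IHl]; first by rewrite !expr0; exact: map_mx1.
    by rewrite !exprS -IHl; exact: map_mxM.
  rewrite -(mxtrace_conj_expr _ _ Pu) -/T.
  by apply: eq_bigr => i _; rewrite (trig_expr k.*2 Ttrig).2.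
apply: le_trans (normc_sum _) _.
apply: le_trans (_ : \sum_(i < n) spectral_radius M ^+ k.*2 <= _).
  apply: ler_sum => i _; rewrite normcX lerXn2r ?nnegrE ?normc_ge0 //.
  exact: normc_le_spectral_radius (eigT i).
by rewrite sumr_const card_ord -[_ *+ n]mulr_natl -exprM mul2n lexx.
Qed.

Lemma norm_le_enorm (v : 'cV[R]_n) i : `|v i 0| <= enorm v.
Proof.
rewrite -sqrtr_sqr ler_sqrt ?sumr_ge0 // => [|j _]; last exact: sqr_ge0.
by rewrite (bigD1 i) //= lerDl sumr_ge0 // => j _; exact: sqr_ge0.
Qed.

Lemma enorm_le (v : 'cV[R]_n) (c : R) : 0 <= c ->
  (forall i, `|v i 0| <= c) -> enorm v <= n%:R * c.
Proof.
move=> c0 vc; rewrite -[leRHS]ger0_norm ?mulr_ge0 // -sqrtr_sqr.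
rewrite ler_sqrt ?sqr_ge0 //.
apply: le_trans (_ : \sum_(i < n) c ^+ 2 <= _).
  apply: ler_sum => i _; rewrite -[v i 0 ^+ 2]ger0_norm ?sqr_ge0 // normrX.
  by rewrite lerXn2r ?nnegrE.
rewrite sumr_const card_ord -[c ^+ 2 *+ n]mulr_natl exprMn ler_wpM2r ?sqr_ge0 //.
by rewrite -natrX ler_nat; nia.
Qed.

Lemma enorm_mulmx_le M (m : R) (v : 'cV[R]_n) : 0 <= m ->
  (forall i j, `|M i j| <= m) -> enorm v <= 1 -> enorm (M *m v) <= n%:R * (n%:R * m).
Proof.
move=> m0 Mm v1; apply: enorm_le => [|i]; first by rewrite mulr_ge0.
rewrite mxE; apply: le_trans (ler_norm_sum _ _ _) _.
apply: le_trans (_ : \sum_(j < n) m <= _).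
  apply: ler_sum => j _; rewrite normrM -[m]mulr1 ler_pM //.
  exact: le_trans (norm_le_enorm v j) v1.
by rewrite sumr_const card_ord mulr_natl.
Qed.

(** With [le_opnorm] this makes the norm of a nonnegative matrix comparable to its largest entry, up
    to a constant depending only on the dimension; exponential growth rates see no more. *)
Lemma opnorm_le M (m : R) : 0 <= m -> (forall i j, `|M i j| <= m) ->
  opnorm M <= n%:R * (n%:R * m).
Proof.
move=> m0 Mm; apply: ge_sup.
  exists (enorm (M *m 0)); exists 0 => //=; rewrite /enorm big1 ?sqrtr0 // => i _.
  by rewrite mxE expr0n.
by move=> _ [v v1 <-]; exact: enorm_mulmx_le.
Qed.

Lemma le_opnorm M i j : M i j <= opnorm M.
Proof.
(* Any common bound on the entries will do: it shows that the set defining [opnorm] is bounded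
   above. *)
have [m m0 Mm] : exists2 m, 0 <= m & forall i j, `|M i j| <= m.
  exists (\sum_i \sum_j `|M i j|); first by rewrite !sumr_ge0 // => k _; rewrite sumr_ge0.
  move=> k l; rewrite (bigD1 k) //= (bigD1 l) //= -addrA lerDl addr_ge0 //.
    by rewrite sumr_ge0.
  by rewrite sumr_ge0 // => p _; rewrite sumr_ge0.
apply: le_trans (_ : enorm (M *m delta_mx j 0) <= _).
  by apply: le_trans (norm_le_enorm _ i); rewrite -colE mxE ler_norm.
apply: ub_le_sup.
  by exists (n%:R * (n%:R * m)) => _ [v v1 <-]; exact: enorm_mulmx_le.
exists (delta_mx j 0) => //=; rewrite /enorm (bigD1 j) //= mxE !eqxx expr1n.
by rewrite big1 ?addr0 ?sqrtr1 // => k /negbTE kj; rewrite mxE kj expr0n.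
Qed.

End NonnegativeMatrices.

(** * Recurrence of the walk *)

Section FinitePartition.
Variables (d : measure_display) (T : measurableType d) (R : realType).
Variable mu : {measure set T -> \bar R}.

Lemma measure_partition (I : finType) (X : T -> I) (A : set T) :
  measurable A -> (forall i, measurable [set w | X w = i]) ->
  mu A = (\sum_i mu (A `&` [set w | X w = i]))%E.
Proof.
move=> mA mX; have seqT : [set` index_enum I] = [set: I].
  by apply/seteqP; split => // i _; rewrite /= mem_index_enum.
rewrite (fsbig_seq _ _ (index_enum_uniq I)) seqT -measure_fin_bigcup.
- by congr (mu _); apply/seteqP; split => [w Aw|w [i _ []]] //; exists (X w).
- exact: finite_finset.
- by move=> i j _ _ [w [[_ <-] [_ <-]]].
- by move=> i _; exact: measurableI.
Qed.

End FinitePartition.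

Lemma exists_letter_neq r (i : 'I_r) (z : letter r) : exists x : letter r, x.1 = i /\ x != z.
Proof.
exists (i, ~~ z.2); split=> //; case: z => j b /=.
by rewrite xpair_eqE; case: b; rewrite andbF.
Qed.

Lemma nielsen_pair_neq r (x y : letter r) : x.1 != y.1 -> nielsen_pair (x, y).
Proof.
by move=> xy; apply/andP; split; apply: contra xy => /eqP /= ->.
Qed.

(** A move of the second admissible kind turns the old source into the multiplier and lets the new
    source lie over [j]; one of the first kind keeps the source and lets the new multiplier lie over
    [i]. The free sign of the new letter avoids the one forbidden inverse. When one move suffices it
    is repeated, every move being admissible after itself. *)
Lemma admissible_two_steps r (t : nielsen r) (i j : 'I_r) : i != j ->
  exists t1 t2, [/\ admissible t t1, admissible t1 t2,
    (nsrc t2).1 = j & (nmul t2).1 = i].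
Proof.
move=> ij.
pose mk x y (xy : x.1 != y.1) : nielsen r :=
  exist [eta @nielsen_pair r] (x, y) (nielsen_pair_neq xy).
have refl (s : nielsen r) : admissible s s.
  by apply/orP; left; rewrite eqxx; case: (nmul s) => k [] /=; rewrite xpair_eqE andbF.
have [xj|xj] := eqVneq (nsrc t).1 j.
  have [y [yi yt]] := exists_letter_neq i (linv (nmul t)).
  have xy : (nsrc t).1 != y.1 by rewrite xj yi eq_sym.
  by exists (mk _ _ xy), (mk _ _ xy); split; rewrite ?refl // /admissible eqxx yt.
have [x [xj' xt]] := exists_letter_neq j (linv (nmul t)).
have xy : x.1 != (nsrc t).1 by rewrite xj' eq_sym.
have adm : admissible t (mk _ _ xy) by rewrite /admissible /= eqxx xt orbT.
have [xi|xi] := eqVneq (nsrc t).1 i.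
  by exists (mk _ _ xy), (mk _ _ xy); split; rewrite ?refl.
have [y [yi yt]] := exists_letter_neq i (linv (nsrc t)).
have xy' : x.1 != y.1 by rewrite xj' yi eq_sym.
by exists (mk _ _ xy), (mk _ _ xy'); split; rewrite // /admissible eqxx yt.
Qed.

Section Recurrence.
Variables (R : realType) (r : nat) (hr : (3 <= r)%N).
Variable mu : probability (trajectory_space hr) R.
Hypothesis hmu : is_walk_measure mu.
Implicit Types (n k : nat) (s : nat -> nielsen r) (t : nielsen r).

(** Cylinders and avoidance events both restrict each coordinate separately, so one measurability
    proof covers them. *)
Let event (P : nat -> pred (nielsen r)) : set (trajectory_space hr) :=
  [set w | forall n, P n (w n)].

Lemma measurable_coordinate n t :
  measurable [set w : trajectory_space hr | w n = t].
Proof. by apply: sub_sigma_algebra; exists n, t. Qed.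

Lemma measurable_event P : measurable (event P).
Proof.
have -> : event P = \bigcap_n \bigcup_(t in [set t | P n t]) [set w | w n = t].
  apply/seteqP; split=> [w Pw n _|w Pw n]; first by exists (w n) => //=; exact: Pw.
  by have [t /= Pt ->] := Pw n I.
apply: bigcapT_measurable => n; apply: fin_bigcup_measurable => [|t _].
  exact: finite_finset.
exact: measurable_coordinate.
Qed.

Let cyl n s : nat -> pred (nielsen r) := fun k t => (k <= n)%N ==> (t == s k).

Let avoid (B : pred (nielsen r)) n s k : nat -> pred (nielsen r) :=
  fun i t => cyl n s i t && ((n < i <= n + k.*2)%N ==> ~~ B t).

Let weight n s : R := initial_prob R r * \prod_(k < n) transition_prob R (s k) (s k.+1).

Lemma mu_cyl n s : mu (event (cyl n s)) = (weight n s)%:E.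
Proof.
rewrite -hmu; congr (mu _); apply/seteqP; split => w /= H k.
  by move=> kn; have := H k; rewrite /cyl kn => /eqP.
by apply/implyP => kn; apply/eqP; exact: H.
Qed.

Let extend n s (p : nielsen r * nielsen r) : nat -> nielsen r :=
  fun i => if i == n.+1 then p.1 else if i == n.+2 then p.2 else s i.

Lemma weight_extend n s p : weight n.+2 (extend n s p) =
  weight n s * (transition_prob R (s n) p.1 * transition_prob R p.1 p.2).
Proof.
rewrite /weight !big_ord_recr /= -!mulrA; congr (_ * (_ * _)).
  apply: eq_bigr => k _; have kn := ltn_ord k.
  by rewrite /extend !ltn_eqF //=; lia.
by rewrite /extend !eqxx ltn_eqF //= ltn_eqF // gtn_eqF.
Qed.

Let q : R := (4 * r - 6)%:R^-1.
(** A prescribed admissible pair of moves has conditional probability q^2, so [c] bounds the chance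
    of missing a target in two steps. *)
Let c : R := 1 - q ^+ 2.

Lemma q_gt0 : 0 < q.
Proof. by rewrite invr_gt0 ltr0n; lia. Qed.

Lemma q_le1 : q <= 1.
Proof. by rewrite invf_le1 ?ltr0n ?ler1n; lia. Qed.

Lemma c_ge0 : 0 <= c.
Proof. by rewrite subr_ge0 expr_le1 ?q_le1 // ltW // q_gt0. Qed.

Lemma c_lt1 : c < 1.
Proof. by rewrite /c ltrBlDr ltrDl exprn_gt0 // q_gt0. Qed.

Lemma measurable_two n p :
  measurable [set w : trajectory_space hr | (w n.+1, w n.+2) = p].
Proof.
have -> : [set w : trajectory_space hr | (w n.+1, w n.+2) = p] =
    [set w | w n.+1 = p.1] `&` [set w | w n.+2 = p.2].
  by case: p => t1 t2; apply/seteqP; split => w /= [-> ->].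
by apply: measurableI; exact: measurable_coordinate.
Qed.

Lemma event_extend n s p : event (cyl n s) `&` [set w | (w n.+1, w n.+2) = p] =
  event (cyl n.+2 (extend n s p)).
Proof.
case: p => t1 t2; apply/seteqP; split => w.
  move=> [ws [w1 w2]] k; apply/implyP => kn; rewrite /extend /=.
  have [->|k1] := eqVneq k n.+1; first by rewrite w1.
  have [->|k2] := eqVneq k n.+2; first by rewrite w2.
  by apply: (implyP (ws k)); lia.
move=> H; have w1 := H n.+1; have w2 := H n.+2.
rewrite /cyl /extend !eqxx leqnn leqnSn ?gtn_eqF //= in w1 w2.
split; last by rewrite /= (eqP w1) (eqP w2).
move=> k; apply/implyP => kn; have := H k; rewrite /cyl /extend /=.
by rewrite !ltn_eqF /= ?ltnS ?(leq_trans kn) // ?leqW.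
Qed.

(** Additivity of [mu] over the values of the next two states, read through its law on cylinders. *)
Lemma sum_weight_extend n s :
  weight n s = \sum_p weight n.+2 (extend n s p).
Proof.
apply: EFin_inj; rewrite -sumEFin -mu_cyl.
rewrite (measure_partition mu (measurable_event _) (measurable_two n)).
by apply: eq_bigr => p _; rewrite event_extend; exact: mu_cyl.
Qed.

(** Induction on the number of two-step blocks: from the last known state some admissible pair of
    moves ends in [B], and discarding it leaves at most the fraction [c] of the cylinder. *)
Lemma mu_avoid (B : pred (nielsen r)) :
  (forall t, exists t1 t2, [/\ admissible t t1, admissible t1 t2 & B t2]) ->
  forall k n s, (mu (event (avoid B n s k)) <= (c ^+ k * weight n s)%:E)%E.
Proof.
move=> hB; elim=> [|k IHk] n s.
  rewrite expr0 mul1r -mu_cyl; apply: le_measure; rewrite ?inE; try exact: measurable_event.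
  by move=> w H i; have /andP[] := H i.
have [t1 [t2 [adm1 adm2 Bt2]]] := hB (s n).
rewrite (measure_partition mu (measurable_event _) (measurable_two n)).
rewrite (bigD1 (t1, t2)) //=.
(* These two moves meet [B] at time n + 2, inside the window where it is forbidden. *)
have -> : event (avoid B n s k.+1) `&` [set w | (w n.+1, w n.+2) = (t1, t2)] = set0.
  apply/seteqP; split => // w [H [_ w2]]; have /andP[_] := H n.+2.
  by rewrite w2 Bt2 /= implybF => /negP; apply; lia.
rewrite measure0 add0e.
apply: le_trans (_ : \sum_(p | p != (t1, t2))
    (c ^+ k * weight n.+2 (extend n s p))%:E <= _)%E.
  apply: lee_sum => p _; apply: le_trans (IHk _ _); apply: le_measure; rewrite ?inE.
  - by apply: measurableI (measurable_two n p); exact: measurable_event.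
  - exact: measurable_event.
  move=> w [H wp] i; apply/andP; split.
    have : (event (cyl n s) `&` [set w | (w n.+1, w n.+2) = p]) w.
      by split=> // j; have /andP[] := H j.
    by rewrite event_extend; apply.
  by apply/implyP => ni; have /andP[_ /implyP] := H i; apply; lia.
rewrite sumEFin lee_fin -mulr_sumr exprSr -mulrA ler_wpM2l ?exprn_ge0 ?c_ge0 //.
have := sum_weight_extend n s; rewrite (bigD1 (t1, t2)) //=.
rewrite weight_extend /= /transition_prob adm1 adm2 -/q -expr2 mulrC => wE.
by rewrite /c mulrBl mul1r lerBrDl -wE.
Qed.

Lemma ae_hits (B : pred (nielsen r)) :
  (forall t, exists t1 t2, [/\ admissible t t1, admissible t1 t2 & B t2]) ->
  {ae mu, forall w : trajectory_space hr, exists n, B (w n)}.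
Proof.
move=> hB; pose never := event (fun _ t => ~~ B t).
suff never0 : mu never = 0%E.
  apply: (@negligibleS _ _ _ _ never); last first.
    exact: (negligibleP mu (measurable_event _)).2 never0.
  by move=> w /= /forallNP H n; apply/negP; exact: H.
(* [mu_avoid] starts from a cylinder, so the event is first split by the initial state. *)
rewrite (measure_partition mu (measurable_event _) (measurable_coordinate 0)).
rewrite big1 // => t _; apply/eqP; rewrite eq_le measure_ge0 andbT.
have le_c k : (mu (never `&` [set w | w 0%N = t]) <= (c ^+ k * weight 0 (fun=> t))%:E)%E.
  apply: le_trans (mu_avoid hB k 0 _); apply: le_measure; rewrite ?inE.
  - by apply: measurableI (measurable_coordinate _ _); exact: measurable_event.
  - exact: measurable_event.
  move=> w [H wt] i; rewrite /avoid /cyl H implybT andbT.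
  by apply/implyP; rewrite leqn0 => /eqP ->; apply/eqP.
have lim0 : c ^+ k * weight 0 (fun=> t) @[k --> \oo] --> (0 : R).
  rewrite -(mul0r (weight 0 (fun=> t))); apply: cvgMl.
  by apply: cvg_expr; rewrite ger0_norm ?c_ge0 ?c_lt1.
have -> : 0%E = limn (fun k => (c ^+ k * weight 0 (fun=> t))%:E).
  by apply/esym/cvg_lim => //; apply: cvg_EFin => //; exact: nearW.
apply: lime_ge; last exact: nearW.
by apply/cvg_ex; exists 0%E; apply: cvg_EFin => //; exact: nearW.
Qed.

Lemma ae_hits_all : {ae mu, forall w : trajectory_space hr, forall i j : 'I_r,
  i != j -> exists n, (nsrc (w n)).1 = j /\ (nmul (w n)).1 = i}.
Proof.
apply: filter_forall => i; apply: filter_forall => j.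
have [->|ij] := eqVneq i j; first by apply: aeW.
have hB t : exists t1 t2, [/\ admissible t t1, admissible t1 t2 &
    ((nsrc t2).1 == j) && ((nmul t2).1 == i)].
  have [t1 [t2 [h1 h2 h3 h4]]] := admissible_two_steps t ij.
  by exists t1, t2; split; rewrite // h3 h4 !eqxx.
have := ae_hits hB; apply: filterS => w [n /andP[/eqP h1 /eqP h2]] _.
by exists n.
Qed.

End Recurrence.

(** * Asymptotic bounds *)

(** Stated in the extended reals to serve both the spectral radius and the stretch factor; the two
    bounds exclude infinite values. *)
Lemma lne_between (R : realType) (C O : R) (x : \bar R) : 0 < C -> 0 < O ->
  ((Num.sqrt O / C)%:E <= x)%E -> (x <= (C * O)%:E)%E ->
  ((ln O / 2 - ln C)%:E <= lne x)%E /\ (lne x <= (ln O + ln C)%:E)%E.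
Proof.
move=> C0 O0 Ox xO.
have sO : 0 < Num.sqrt O by rewrite sqrtr_gt0.
have lnsqrt : ln (Num.sqrt O) = ln O / 2.
  by rewrite -{2}(sqr_sqrtr (ltW O0)) lnXn // -[ln _ *+ 2]mulr_natr mulfK.
case: x Ox xO => [x| |] //; rewrite !lee_fin => Ox xO.
have lo0 : 0 < Num.sqrt O / C by rewrite divr_gt0.
have x0 : 0 < x by exact: lt_le_trans Ox.
rewrite lne_EFin // !lee_fin -lnsqrt -ln_div ?posrE // addrC -lnM ?posrE //.
by split; rewrite ler_ln ?posrE // mulr_gt0.
Qed.

(** Common end of both claims: the term ln C / k(i) vanishes in the limit, and the square root
    halves the exponent in the lower bound. *)
Lemma liminf_limsup_between (R : realType) (C l1 : R) (O : R^nat) (k : nat -> nat)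
    (x : (\bar R)^nat) : 0 < C -> 0 < l1 ->
  n%:R^-1 * ln (O n) @[n --> \oo] --> l1 -> k @ \oo --> \oo ->
  (\forall i \near \oo, 0 < O (k i) /\
     ((Num.sqrt (O (k i)) / C)%:E <= x i <= (C * O (k i))%:E)%E) ->
  let v := fun i => (((k i)%:R^-1)%:E * lne (x i))%E in
  [/\ 0 < l1 / 2, ((l1 / 2)%:E <= limn_einf v)%E,
      (limn_einf v <= limn_esup v)%E & (limn_esup v <= l1%:E)%E].
Proof.
move=> C0 l10 Ol koo bounds v.
have kV : (k i)%:R^-1 @[i --> \oo] --> (0 : R).
  exact: (cvg_comp k (fun n => n%:R^-1) koo (@cvg_natV R)).
have Ok : (k i)%:R^-1 * ln (O (k i)) @[i --> \oo] --> l1.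
  exact: (cvg_comp k (fun n => n%:R^-1 * ln (O n)) koo Ol).
have lb : (k i)%:R^-1 * ln (O (k i)) * 2^-1 - ln C * (k i)%:R^-1 @[i --> \oo] --> l1 / 2.
  have : l1 / 2 - ln C * 0 = l1 / 2 by rewrite mulr0 subr0.
  by move=> <-; apply: cvgB; [exact: cvgMl | exact: cvgMr].
have ub : (k i)%:R^-1 * ln (O (k i)) + ln C * (k i)%:R^-1 @[i --> \oo] --> l1.
  have : l1 + ln C * 0 = l1 by rewrite mulr0 addr0.
  by move=> <-; apply: cvgD => //; exact: cvgMr.
split; [by rewrite divr_gt0 | | exact: limn_einf_sup |].
  apply: limn_einf_ge lb _; apply: filterS bounds => i [opos /andP[lo hi]].
  have [lo' _] := lne_between C0 opos lo hi.
  apply: le_trans (lee_wpmul2l _ lo'); last by rewrite lee_fin invr_ge0.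
  by rewrite -EFinM lee_fin mulrBr mulrA [ln C * _]mulrC.
apply: limn_esup_le ub _; apply: filterS bounds => i [opos /andP[lo hi]].
have [_ hi'] := lne_between C0 opos lo hi.
apply: le_trans (lee_wpmul2l _ hi') _; first by rewrite lee_fin invr_ge0.
by rewrite -EFinM lee_fin mulrDr [ln C * _]mulrC.
Qed.

Section PositiveMaps.
Variables (R : realType) (r : nat) (f : rose_map r).
Hypotheses (r0 : (0 < r)%N) (fpos : forall i j, (0 < occ i (f j))%N).

Let M := transition_mx R f.

Let M_ge0 i j : 0 <= M i j.
Proof. by rewrite transition_mxE. Qed.

Lemma max_occ : exists a b, forall i j, (occ i (f j) <= occ a (f b))%N.
Proof.
pose i0 := Ordinal r0.
case: (@arg_maxnP _ (i0, i0) xpredT (fun p : 'I_r * 'I_r => occ p.1 (f p.2))) => //.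
by move=> [a b] _ H; exists a, b => i j; exact: (H (i, j)).
Qed.

Variables (a b : 'I_r).
Hypothesis abmax : forall i j, (occ i (f j) <= occ a (f b))%N.

Lemma opnorm_gt0 : 0 < opnorm M.
Proof.
by apply: lt_le_trans (le_opnorm M a b); rewrite transition_mxE ltr0n.
Qed.

Lemma size_le_max i : (size (f i) <= r * occ a (f b))%N.
Proof.
rewrite size_occ; apply: leq_trans (leq_sum _ (fun k _ => abmax k i)) _.
by rewrite sum_nat_const card_ord.
Qed.

Lemma max_le_opnorm : (r * occ a (f b))%:R <= r%:R * opnorm M.
Proof.
by rewrite natrM ler_wpM2l // -transition_mxE; exact: le_opnorm.
Qed.

(** The norm is at most r^2 times the largest entry; the square root turns r^2 into r. *)
Lemma sqrt_opnorm_le : Num.sqrt (opnorm M) / r%:R <= Num.sqrt (occ a (f b))%:R.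
Proof.
rewrite ler_pdivrMr ?ltr0n // -[r%:R in leRHS](ger0_norm) // -sqrtr_sqr.
rewrite -sqrtrM // ler_sqrt ?mulr_ge0 ?sqr_ge0 // mulrC expr2 -mulrA.
by apply: opnorm_le => // i j; rewrite ger0_norm // transition_mxE ler_nat.
Qed.

Lemma spectral_radius_between :
  Num.sqrt (opnorm M) / r%:R <= spectral_radius M <= r%:R * opnorm M.
Proof.
apply/andP; split.
  apply: le_trans sqrt_opnorm_le _; apply: le_trans (spectral_radius_ge a b M_ge0).
  (* The opposite entry [M b a] is a positive integer, so dropping it only decreases the product. *)
  by rewrite ler_sqrt ?mulr_ge0 // !transition_mxE -natrM ler_nat leq_pmulr.
apply: le_trans max_le_opnorm; apply: spectral_radius_le => // j.
rewrite (eq_bigr (fun i => (occ i (f j))%:R)); last by move=> i _; exact: transition_mxE.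
by rewrite -natr_sum -size_occ ler_nat size_le_max.
Qed.

End PositiveMaps.

Lemma stretch_factor_between (R : realType) r (ts : seq (nielsen r)) (phi : Out r)
    (f := rose_of_seq ts) (M := transition_mx R f) : (1 < r)%N ->
  (forall i j, (0 < occ i (f j))%N) -> cyclically_admissible ts -> represents f phi ->
  ((Num.sqrt (opnorm M) / r%:R)%:E <= stretch_factor R phi <= (r%:R * opnorm M)%:E)%E.
Proof.
move=> r1 fpos adm frep; have r0 := ltnW r1.
have [a [b abmax]] := max_occ f r0; apply/andP; split.
  apply: le_trans (stretch_factor_ge R a b r1 adm frep fpos).
  by rewrite lee_fin; exact: sqrt_opnorm_le.
apply: le_trans (_ : ((r * occ a (f b))%:R%:E <= _)%E); last first.
  by rewrite lee_fin; exact: max_le_opnorm.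
apply: stretch_factor_le frep _ _; first by rewrite muln_gt0 r0 fpos.
exact: size_le_max.
Qed.

Lemma near_occ_gt0 r (w : nat -> nielsen r) :
  (forall i j : 'I_r, i != j -> exists n, (nsrc (w n)).1 = j /\ (nmul (w n)).1 = i) ->
  \forall n \near \oo, forall i j, (0 < occ i (rose_of_seq (mkseq w n) j))%N.
Proof.
move=> hits; apply: filter_forall => i; apply: filter_forall => j.
have [/eqP ->|ij] := boolP (i == j).
  by apply: nearW => n; exact: occ_rose_of_seq.
have [N [<- <-]] := hits i j ij; exists N.+1 => // n /= Nn.
apply: occ_rose_of_seq_mem; apply/mapP; exists N => //.
by rewrite mem_iota.
Qed.

(** The diagonal is positive for every sequence, even before all entries are, so [ln] may be
    exchanged for [lne] at every index. *)
Lemma spectral_radius_gt0 (R : realType) r (ts : seq (nielsen r)) : (0 < r)%N ->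
  0 < spectral_radius (transition_mx R (rose_of_seq ts)).
Proof.
move=> r0; pose i := Ordinal r0.
apply: lt_le_trans (spectral_radius_ge i i _) => [|k l]; last by rewrite transition_mxE.
by rewrite sqrtr_gt0 mulr_gt0 // transition_mxE ltr0n occ_rose_of_seq.
Qed.

Lemma strictly_increasing_cvgy (m : nat -> nat) :
  {homo m : i j / (i < j)%N >-> (i < j)%N} -> m @ \oo --> \oo.
Proof.
move=> mS; apply/cvgnyPge => N; exists N => // i /= Ni; apply: leq_trans Ni _.
by elim: i => // i IHi; apply: leq_ltn_trans IHi (mS _ _ _).
Qed.

Theorem theorem5p15 (R : realType) (r : nat) (hr : (3 <= r)%N)
    (mu : probability (trajectory_space hr) R) (hmu : is_walk_measure mu)
    (l1 : R) (l1_gt0 : 0 < l1) (hl1 : is_top_lyapunov mu l1) :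
  {ae mu, forall w : trajectory_space hr,
    (let u := fun n : nat => (n%:R^-1 *
       ln (spectral_radius (transition_mx R (rose_of_seq (mkseq w n)))))%:E in
     [/\ 0 < l1 / 2,
         ((l1 / 2)%:E <= limn_einf u)%E,
         (limn_einf u <= limn_esup u)%E &
         (limn_esup u <= l1%:E)%E]) /\
    (forall (m : nat -> nat) (phi : nat -> Out r),
       (1 <= m 0)%N ->
       {homo m : i j / (i < j)%N >-> (i < j)%N} ->
       (forall i, cyclically_admissible (mkseq w (m i))) ->
       (forall i, represents (rose_of_seq (mkseq w (m i))) (phi i)) ->
       let v := fun i : nat =>
         (((m i)%:R^-1)%:E * lne (stretch_factor R (phi i)))%E in
       [/\ 0 < l1 / 2,
           ((l1 / 2)%:E <= limn_einf v)%E,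
           (limn_einf v <= limn_esup v)%E &
           (limn_esup v <= l1%:E)%E])}.
Proof.
have r0 : (0 < r)%N by exact: ltnW (ltnW hr).
have r1 : (1 < r)%N by exact: ltnW hr.
have rR : (0 : R) < r%:R by rewrite ltr0n.
apply: filterS2 (ae_hits_all hmu) hl1 => w /near_occ_gt0 fpos lyap.
pose O n := opnorm (transition_mx R (rose_of_seq (mkseq w n))).
have Ol : n%:R^-1 * ln (O n) @[n --> \oo] --> l1.
  by rewrite /O; under eq_fun do rewrite transition_mx_of_seq.
split=> [|m phi m0 mS adm rep].
  pose x n := (spectral_radius (transition_mx R (rose_of_seq (mkseq w n))))%:E.
  have -> : (fun n => (n%:R^-1 *
      ln (spectral_radius (transition_mx R (rose_of_seq (mkseq w n)))))%:E) =
    (fun n => ((n%:R^-1)%:E * lne (x n))%E).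
    by apply/funext => n; rewrite /x lne_EFin // spectral_radius_gt0.
  (* The full sequence is the case of the identity reindexing, with constant C = r. *)
  apply: (@liminf_limsup_between _ r%:R _ O id) => //.
  apply: filterS fpos => n fpos.
  have [a [b abmax]] := max_occ (rose_of_seq (mkseq w n)) r0.
  split; first exact: opnorm_gt0 fpos a b.
  by rewrite !lee_fin; exact: spectral_radius_between abmax.
have moo := strictly_increasing_cvgy mS.
apply: (@liminf_limsup_between _ r%:R _ O m) => //.
have fposm : \forall i \near \oo, forall k l,
    (0 < occ k (rose_of_seq (mkseq w (m i)) l))%N := moo _ fpos.
apply: filterS fposm => i fposi.
have [a [b abmax]] := max_occ (rose_of_seq (mkseq w (m i))) r0.
split; first exact: opnorm_gt0 fposi a b.
exact: stretch_factor_between.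
Qed.
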